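(* Let $\mathsf{k}$ be a field of positive characteristic, $n\ge 1$, and let $\mathbf a=(a_1,\dots,a_n)$, $\mathbf b=(b_1,\dots,b_n)$ be vectors of positive integers. If $a_i=b_i$ for all $i=1,\dots,n$, then $\mathrm e_{HK}(\mathcal B)=2-s(\mathcal B)$, where $\mathcal B=\mathcal B(\mathbf a,\mathbf b)$ (with $\mathsf{k}$ $F$-finite in this identity, so that $s(\mathcal B)$ is defined). In particular: (1) For $n=1$ and $a=b$, $$\mathrm e_{HK}(\mathcal B(a,a))=2-\frac{3a-1}{3a^2}=\frac{1-3a+6a^2}{3a^2}.$$ (2) In general, if $a_1\ge a_2\ge\cdots\ge a_n$, $$\mathrm e_{HK}(\mathcal B(\mathbf a,\mathbf a))=2-2\left(1-\frac1{a_1}\right)\sum_{k=1}^n(-1)^{k+1}\frac{S_{k-1}(a_2,\dots,a_n)}{k(k+1)a_1^k}-4\sum_{k=1}^n(-1)^{k+1}\frac{S_{k-1}(a_2,\dots,a_n)}{k(k+1)(k+2)a_1^{k+1}}.$$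
   Context: $\mathbb N=\mathbb Z_{\ge 0}$. $S_k(c_1,\dots,c_m)$ denotes the elementary symmetric polynomial of degree $k$ in $c_1,\dots,c_m$ (with $S_0=1$). Let $R=\mathsf{k}[x_1,\dots,x_n]$, $I=(x_1^{a_1}\cdots x_n^{a_n})$, $J=(x_1^{b_1}\cdots x_n^{b_n})$. The intersection algebra is $\mathcal B(\mathbf a,\mathbf b)=\bigoplus_{r,s\in\mathbb N}(I^r\cap J^s)$, realized as the subring $\sum_{r,s}(I^r\cap J^s)u^rv^s$ of $R[u,v]$; it is a normal domain of dimension $d=n+2$ with homogeneous maximal ideal $\mathfrak m$ generated by its monomials $\ne1$. With $p=\operatorname{char}\mathsf{k}$, the Hilbert-Kunz multiplicity is $\mathrm e_{HK}(\mathcal B)=\mathrm e_{HK}(\mathfrak m,\mathcal B)=\lim_{e\to\infty}\operatorname{length}(\mathcal B/\mathfrak m^{[p^e]})/p^{ed}$. $\mathsf{k}$ is $F$-finite if $[\mathsf{k}:\mathsf{k}^p]<\infty$. The $F$-signature $s(\mathcal B)$ of $\mathcal B$ as a graded ring is that of $\mathcal B_{\mathfrak m}$: $\lim_{e\to\infty} c_e/p^{e(d+\alpha)}$, where $p^\alpha=[\mathsf{k}:\mathsf{k}^p]$ and $c_e$ is the maximal rank of a free direct summand of $F^e_*\mathcal B_{\mathfrak m}$ as a $\mathcal B_{\mathfrak m}$-module. *)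

(* Defs.v *)
From HB Require Import structures.
From mathcomp Require Import all_boot all_order all_algebra.
From mathcomp Require Import all_classical all_reals all_analysis.
(* The notations of mpoly clash with those of mathcomp-analysis. *)
From mathcomp Require Import -(notations) mpoly.

Set Implicit Arguments.
Unset Strict Implicit.
Unset Printing Implicit Defensive.

Import Order.TTheory GRing.Theory Num.Theory.
Import numFieldNormedType.Exports.

Local Open Scope classical_set_scope.
Local Open Scope ring_scope.

(* Rings such as B and B_m are represented by subsets [B] of an ambient
   commutative ring [A]; the definitions below are meant for [B] a subring. *)

Definition is_ideal (A : comNzRingType) (B I : set A) : Prop :=
  [/\ I `<=` B, I 0, forall x y, I x -> I y -> I (x + y)
    & forall r x, B r -> I x -> I (r * x)].

Definition ideal_gen (A : comNzRingType) (B G : set A) : set A :=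
  smallest (is_ideal B) G.

Definition ideal_pow (A : comNzRingType) (B I : set A) (r : nat) : set A :=
  ideal_gen B [set x | exists2 y : 'I_r -> A,
                         forall j, I (y j) & x = \prod_(j < r) y j].

Definition bracket_pow (A : comNzRingType) (B I : set A) (q : nat) : set A :=
  ideal_gen B [set x ^+ q | x in I].

(* Length of the B-module B / I, as the supremum of the lengths of the strictly
   increasing chains of its submodules, i.e., of ideals of B containing I. *)
Definition ideal_chain (A : comNzRingType) (B I : set A) (l : nat) : Prop :=
  exists C : nat -> set A,
    [/\ forall i, (i <= l)%N -> is_ideal B (C i), I `<=` C 0%N
      & forall i, (i < l)%N -> C i `<` C i.+1].

Definition quotient_length (R : realType) (A : comNzRingType) (B I : set A) :
  \bar R := ereal_sup [set (l%:R)%:E | l in ideal_chain B I].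

(* e_HK(I, B) = l, where p is the characteristic and d the dimension of B. *)
Definition is_HilbertKunz (R : realType) (p d : nat) (A : comNzRingType)
    (B I : set A) (l : R) : Prop :=
  (fun e : nat => quotient_length R B (bracket_pow B I (p ^ e)) *
                  ((p%:R ^+ (e * d))^-1)%:E)%E @ \oo --> l%:E.

(* For q = p^e, the module F^e_* B has underlying set B, and r in B acts on it
   by x |-> r^q x. *)

Definition frob_submodule (A : comNzRingType) (B : set A) (q : nat)
    (M : set A) : Prop :=
  [/\ M `<=` B, M 0, forall x y, M x -> M y -> M (x + y)
    & forall r x, B r -> M x -> M (r ^+ q * x)].

Definition frob_free (A : comNzRingType) (B : set A) (q : nat) (M : set A)
    (c : nat) : Prop :=
  exists2 w : 'I_c -> A, forall i, M (w i) &
    forall x, M x -> exists! r : {ffun 'I_c -> A},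
      (forall i, B (r i)) /\ x = \sum_i r i ^+ q * w i.

Definition frob_free_summand (A : comNzRingType) (B : set A) (q c : nat) :
    Prop :=
  exists M N : set A,
    [/\ frob_submodule B q M, frob_submodule B q N, frob_free B q M c,
        M `&` N = [set 0] &
        forall x, B x -> exists y z, [/\ M y, N z & x = y + z]].

Definition max_free_rank (R : realType) (A : comNzRingType) (B : set A)
    (q : nat) : \bar R :=
  ereal_sup [set (c%:R)%:E | c in frob_free_summand B q].

(* [k : k^p] = D *)
Definition frob_degree (k : fieldType) (p D : nat) : Prop :=
  exists w : 'I_D -> k, forall x : k, exists! c : {ffun 'I_D -> k},
    (forall i, range (fun y : k => y ^+ p) (c i)) /\ x = \sum_i c i * w i.

Definition F_finite (k : fieldType) (p : nat) : Prop :=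
  exists D : nat, frob_degree k p D.

(* s(B) = s, for B local of dimension d with residue field k. *)
Definition is_Fsignature (R : realType) (k : fieldType) (p d : nat)
    (A : comNzRingType) (B : set A) (s : R) : Prop :=
  exists (D : nat) (alpha : R),
    [/\ frob_degree k p D, p%:R `^ alpha = D%:R &
        (fun e : nat => max_free_rank R B (p ^ e) *
           ((p%:R `^ (e%:R * (d%:R + alpha)))^-1)%:E)%E @ \oo --> s%:E].

(* The localization of B at P, inside the fraction field of the ambient ring. *)
Definition localization (A : idomainType) (B P : set A) : set {fraction A} :=
  [set x | exists f g : A, [/\ B f, B g, ~ P g &
             x = FracField.tofrac f / FracField.tofrac g]].

(* R = k[x_1, ..., x_n] and R[u, v]: the exponents of u and v in a monomial e
   are e ord0 and e ord_max. *)
Definition polyR (k : fieldType) (n : nat) : idomainType := mpoly n k.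
Definition polyRuv (k : fieldType) (n : nat) : idomainType :=
  mpoly 2 (polyR k n).

Definition monomial_ideal (k : fieldType) (n : nat) (a : 'I_n -> nat) :
    set (polyR k n) :=
  ideal_gen setT
    [set (\prod_(i < n) mpolyX k (mnm1 i) ^+ a i : polyR k n)].
Arguments monomial_ideal k {n} a _.

(* sum_(r, s) (I^r /\ J^s) u^r v^s *)
Definition int_alg (k : fieldType) (n : nat) (a b : 'I_n -> nat) :
    set (polyRuv k n) :=
  [set f | forall e : multinom 2,
     (ideal_pow setT (monomial_ideal k a) (e ord0) `&`
      ideal_pow setT (monomial_ideal k b) (e ord_max)) (mcoeff e f)].
Arguments int_alg k {n} a b _.

(* x^c u^(e ord0) v^(e ord_max) *)
Definition monomial_uv (k : fieldType) (n : nat) (c : multinom n)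
    (e : multinom 2) : polyRuv k n :=
  mpolyC 2 (mpolyX k c : polyR k n) * mpolyX (polyR k n) e.

Definition int_alg_max (k : fieldType) (n : nat) (a b : 'I_n -> nat) :
    set (polyRuv k n) :=
  ideal_gen (int_alg k a b)
    [set f | [/\ int_alg k a b f, f <> 1 &
                 exists c e, f = monomial_uv k c e]].
Arguments int_alg_max k {n} a b _.

(* Both invariants below use that the intersection algebra has dimension
   n + 2. *)
Definition int_alg_eHK (R : realType) (k : fieldType) (p n : nat)
    (a b : 'I_n -> nat) (l : R) : Prop :=
  is_HilbertKunz p n.+2 (int_alg k a b) (int_alg_max k a b) l.

Definition int_alg_Fsig (R : realType) (k : fieldType) (p n : nat)
    (a b : 'I_n -> nat) (s : R) : Prop :=
  is_Fsignature k p n.+2 (localization (int_alg k a b) (int_alg_max k a b)) s.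

(* S_j(c_1, ..., c_m) *)
Definition elem_sym (R : realType) (m j : nat) (c : 'I_m -> nat) : R :=
  meval (fun i => (c i)%:R) (mesym m R j).

(* Main.v *)
Require Import Defs.
From mathcomp Require Import all_boot all_order all_algebra.
From mathcomp Require Import all_classical all_reals all_analysis.
From mathcomp Require Import -(notations) mpoly.
From mathcomp Require Import zify ring.
Import Order.TTheory GRing.Theory Num.Theory.
Import numFieldNormedType.Exports.

Set Implicit Arguments.
Unset Strict Implicit.
Unset Printing Implicit Defensive.

Local Open Scope classical_set_scope.
Local Open Scope ring_scope.

(** When [a = b], the algebra [B] is spanned by the monomials [x^c u^r v^s]
    with [c_i >= a_i max(r, s)]: its exponents form the set [cone a] of lattice
    points on which the facet functionals [r], [s], [c_i - a_i r] and
    [c_i - a_i s] are nonnegative.  Both invariants then count lattice points.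

    Hilbert-Kunz multiplicity.  The ideal [m^[q]] is spanned by the monomials
    with exponent [q z + v], where [z, v] lie in the cone and [z <> 0]
    ([bracket_powE]), and the length of the quotient by a monomial ideal is the
    number of exponents of the cone outside it ([quotient_length_span]).

    F-signature.  Let [q = p^e] and let [frob_box] be the finite set of the
    exponents whose facet functionals are all less than [q].  If [w] is in this
    box then the exponents of the cone congruent to [w] modulo [q] are exactly
    [w + q v] with [v] in the cone; so each [w] in the box and each element of
    a basis of [k] over [k^q] give a free rank one summand of [F^e_* B], and
    these split off together ([free_summand]).  If [w] is in the cone but not
    in the box, some facet functional has value at least [q] on [w], and every
    linear map from [F^e_* B_m] to [B_m] sends [x^w] into the maximal ideal
    ([residue_not_frob_box]).  A free summand of rank [c] therefore factors the
    identity matrix of size [c] through the span of the box, which bounds [c]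
    ([free_summand_le]).

    Write an exponent as [c_i = d_i + a_i max(r, s)], with minimum [s] and
    difference [t] of the exponents of [u] and [v].  The box is given by
    [s + t < q] and [d_i + a_i t < q].  The complement of [m^[q]] is given by
    [d_i, s, t < q] and either [s + t < q] or [d_i < a_i (q - t)] for some [i];
    the points with [d_i, s, t < q] that fail this alternative become, after
    reflection of [t] and [d], the points of the box with [t > 0].  Hence the
    two cardinals add up to [2 q^(n+2)] ([card_hk_box]), which in the limit says
    that the Hilbert-Kunz multiplicity and the F-signature add up to 2.

    The box has [2 (\sum_(t < q) (q - t) \prod_i (q - a_i t)_+) - q^(n+1)]
    points ([card_sig_box]).  After division by [q^(n+2)] this is a Riemann sum
    for twice the integral of [(1 - y) \prod_i (1 - a_i y)] over
    [[0, 1 / max a_i]] ([sig_box_cvg]).  Expanding the product in elementary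
    symmetric polynomials and integrating term by term gives the closed
    formula. *)

(** * The Frobenius map *)

Lemma Frobenius_sum (A : comNzRingType) (p e : nat) (I : Type) (s : seq I)
    (F : I -> A) : p \in [pchar A] ->
  (\sum_(i <- s) F i) ^+ (p ^ e) = \sum_(i <- s) F i ^+ (p ^ e).
Proof.
move=> hp; have p_pr := pcharf_prime hp.
elim: s => [|x s IHs]; first by rewrite !big_nil expr0n expn_eq0; case: p p_pr {hp}.
rewrite !big_cons -IHs exprDn_pchar // pnatX; apply/orP; left.
by rewrite pnatE.
Qed.

Lemma Frobenius_add (A : comNzRingType) (p e : nat) (x y : A) :
  p \in [pchar A] -> (x + y) ^+ (p ^ e) = x ^+ (p ^ e) + y ^+ (p ^ e).
Proof.
move=> hp; have := Frobenius_sum e [:: x; y] id hp.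
by rewrite !big_cons !big_nil !addr0.
Qed.

Lemma Frobenius_opp (A : comNzRingType) (p e : nat) (x : A) :
  p \in [pchar A] -> (- x) ^+ (p ^ e) = - x ^+ (p ^ e).
Proof.
move=> hp; apply/eqP; rewrite -addr_eq0 -Frobenius_add // addNr expr0n expn_eq0.
by case: p hp => // /pcharf_prime.
Qed.

(** * Coefficients of polynomials in x, u and v *)

Section Coefficients.
Variables (k : fieldType) (n : nat).
Local Notation P := (polyRuv k n).

(** The exponents of the [x_i], then those of [u] and [v]. *)
Definition expo := (multinom n * multinom 2)%type.

Definition eadd (u v : expo) : expo := (mnm_add u.1 v.1, mnm_add u.2 v.2).
Definition emul (q : nat) (u : expo) : expo := (mnm_muln u.1 q, mnm_muln u.2 q).
Definition ezero : expo := (@mnm0 n, @mnm0 2).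

Definition ecoef (w : expo) (f : P) : k := mcoeff w.1 (mcoeff w.2 f).
Definition econst (x : k) : P := mpolyC 2 (mpolyC n x : polyR k n).
Definition mono (w : expo) : P := monomial_uv k w.1 w.2.
Definition esupp (f : P) : seq expo :=
  [seq (c, e) | e <- msupp f, c <- msupp (mcoeff e f)].

Lemma expoP (u v : expo) :
  (forall i, u.1 i = v.1 i) -> (forall b, u.2 b = v.2 b) -> u = v.
Proof. by case: u v => [a b] [c d] /= h1 h2; congr pair; apply/mnmP. Qed.

Lemma eaddC : commutative eadd.
Proof. by move=> u v; apply: expoP => i; rewrite !mnmDE addnC. Qed.

Lemma eaddA : associative eadd.
Proof. by move=> u v w; apply: expoP => i; rewrite !mnmDE addnA. Qed.

Lemma eadd0 : right_id ezero eadd.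
Proof. by move=> u; apply: expoP => i; rewrite mnmDE mnm0E addn0. Qed.

Lemma eaddI u : injective (eadd u).
Proof.
move=> v w h; apply: expoP => i.
  by have := congr1 (fun w : expo => w.1 i) h; rewrite !mnmDE => /addnI.
by have := congr1 (fun w : expo => w.2 i) h; rewrite !mnmDE => /addnI.
Qed.

Lemma eadd_eq0 u v : eadd u v = ezero -> u = ezero.
Proof.
move=> h; apply: expoP => i; apply/eqP; rewrite mnm0E -leqn0.
  by have := congr1 (fun w : expo => w.1 i) h; rewrite mnmDE mnm0E; lia.
by have := congr1 (fun w : expo => w.2 i) h; rewrite mnmDE mnm0E; lia.
Qed.

Lemma ecoef_inj (f g : P) : (forall w, ecoef w f = ecoef w g) -> f = g.
Proof. by move=> h; apply/mpolyP => e; apply/mpolyP => c; apply: (h (c, e)). Qed.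

Lemma ecoefD w (f g : P) : ecoef w (f + g) = ecoef w f + ecoef w g.
Proof. by rewrite /ecoef !mcoeffD. Qed.

Lemma ecoef0 w : ecoef w 0 = 0. Proof. by rewrite /ecoef !mcoeff0. Qed.

Lemma ecoef_sum w (I : Type) (s : seq I) (Q : pred I) (F : I -> P) :
  ecoef w (\sum_(i <- s | Q i) F i) = \sum_(i <- s | Q i) ecoef w (F i).
Proof. exact: (big_morph _ (ecoefD w) (ecoef0 w)). Qed.

Lemma ecoef_constM w x (f : P) : ecoef w (econst x * f) = x * ecoef w f.
Proof. by rewrite /ecoef !mcoeffCM. Qed.

Lemma ecoef_mono w u : ecoef w (mono u) = (u == w)%:R.
Proof.
rewrite /ecoef /mono /monomial_uv mcoeffCM mcoeffX.
case: u w => [c e] [c' e'] /=; rewrite xpair_eqE andbC.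
by case: (e == e'); rewrite ?mulr1 ?mulr0 ?mcoeffX ?mcoeff0.
Qed.

Lemma mono0 : mono ezero = 1.
Proof. by rewrite /mono /monomial_uv !mpolyX0 mpolyC1 mul1r. Qed.

Lemma monoD u v : mono (eadd u v) = mono u * mono v.
Proof. by rewrite /mono /monomial_uv /= !mpolyXD mpolyCM mulrACA. Qed.

Lemma monoX u q : mono (emul q u) = mono u ^+ q.
Proof. by rewrite /mono /monomial_uv exprMn !mpolyXn /= -mpolyXn rmorphXn. Qed.

Lemma econst1 : econst 1 = 1. Proof. by rewrite /econst !mpolyC1. Qed.

Lemma econst0 : econst 0 = 0. Proof. by rewrite /econst !mpolyC0. Qed.

Lemma econstM x y : econst (x * y) = econst x * econst y.
Proof. by rewrite /econst !mpolyCM. Qed.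

Lemma econstX x q : econst (x ^+ q) = econst x ^+ q.
Proof. by rewrite /econst !rmorphXn. Qed.

Lemma mem_esupp f w : (w \in esupp f) = (ecoef w f != 0).
Proof.
apply/allpairsPdep/idP => [[e [c [he hc ->]]]|].
  by rewrite /ecoef -mcoeff_msupp.
case: w => c e hw; exists e, c; split=> //; rewrite mcoeff_msupp //.
by apply: contra_neq hw => h; rewrite /ecoef h mcoeff0.
Qed.

Lemma esupp_uniq f : uniq (esupp f).
Proof.
apply: allpairs_uniq_dep; first exact: msupp_uniq.
  by move=> e _; apply: msupp_uniq.
by move=> [e c] [e' c'] _ _ /= [-> ->].
Qed.

Lemma polyE f : f = \sum_(w <- esupp f) econst (ecoef w f) * mono w.
Proof.
rewrite big_allpairs_dep /= [LHS]mpolyE; apply: eq_bigr => e _.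
rewrite -mul_mpolyC [in LHS](mpolyE (mcoeff e f)) rmorph_sum mulr_suml.
apply: eq_bigr => c _ /=.
by rewrite /mono /monomial_uv /= -mul_mpolyC mpolyCM mulrA.
Qed.

Lemma ecoef_monoM u w f : ecoef (eadd u w) (mono u * f) = ecoef w f.
Proof.
rewrite [f in LHS]polyE mulr_sumr [f in RHS]polyE !ecoef_sum.
apply: eq_bigr => v _; rewrite mulrCA -monoD !ecoef_constM !ecoef_mono.
by rewrite (inj_eq (@eaddI u)).
Qed.

Lemma ecoef_monoM_neq0 u w f :
  ecoef w (mono u * f) != 0 -> exists2 v, w = eadd u v & ecoef v f != 0.
Proof.
move=> h; suff: has (fun v => w == eadd u v) (esupp f).
  by case/hasP=> v; rewrite mem_esupp => hv /eqP ->; exists v.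
apply: contraNT h => /hasPn h; apply/eqP.
rewrite [f]polyE mulr_sumr ecoef_sum big1_seq // => v /andP[_ /h].
by rewrite mulrCA -monoD ecoef_constM ecoef_mono eq_sym => /negbTE ->; rewrite mulr0.
Qed.

Lemma ecoefM_neq0 w f g : ecoef w (f * g) != 0 ->
  exists u v, [/\ w = eadd u v, ecoef u f != 0 & ecoef v g != 0].
Proof.
move=> h; suff: has (fun u => ecoef w (mono u * g) != 0) (esupp f).
  case/hasP=> u; rewrite mem_esupp => hu /ecoef_monoM_neq0[v -> hv].
  by exists u, v.
apply: contraNT h => /hasPn h; apply/eqP.
rewrite [f]polyE mulr_suml ecoef_sum big1_seq // => u /andP[_ /h].
by rewrite negbK -mulrA ecoef_constM => /eqP ->; rewrite mulr0.
Qed.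

Lemma ecoef0M f g : ecoef ezero (f * g) = ecoef ezero f * ecoef ezero g.
Proof. by rewrite /ecoef /= !rmorphM. Qed.

Lemma ecoef0_1 : ecoef ezero 1 = 1.
Proof. by rewrite /ecoef /= !rmorph1. Qed.

Lemma pchar_polyRuv p : p \in [pchar k] -> p \in [pchar P].
Proof.
move=> hp; have hR : p \in [pchar (polyR k n)].
  exact: (rmorph_pchar (@mpolyC n k : {rmorphism _ -> _}) hp).
exact: (rmorph_pchar (@mpolyC 2 (polyR k n) : {rmorphism _ -> _}) hR).
Qed.

Lemma polyX_Frobenius p e f : p \in [pchar k] ->
  f ^+ (p ^ e) =
    \sum_(w <- esupp f) econst (ecoef w f ^+ (p ^ e)) * mono (emul (p ^ e) w).
Proof.
move=> hp; rewrite [f in LHS]polyE (Frobenius_sum _ _ _ (pchar_polyRuv hp)).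
by apply: eq_bigr => w _; rewrite exprMn econstX monoX.
Qed.

End Coefficients.

(** * Generated ideals *)

Section Ideals.
Variables (A : comNzRingType) (B : set A).
Hypothesis idealB : is_ideal B B.

Lemma ideal_gen_min G I : is_ideal B I -> G `<=` I -> ideal_gen B G `<=` I.
Proof. by move=> hI hG x; apply; split. Qed.

Lemma sub_ideal_gen G : G `<=` ideal_gen B G.
Proof. by move=> x hx I [_]; apply. Qed.

Lemma ideal_gen_ideal G : G `<=` B -> is_ideal B (ideal_gen B G).
Proof.
move=> hG; split.
- by apply: ideal_gen_min.
- by move=> I [[_ h _ _] _].
- by move=> x y hx hy I hI; case: (hI.1) => _ _ h _; apply: h; [apply: hx | apply: hy].
- by move=> r x hr hx I hI; case: (hI.1) => _ _ _ h; apply: h => //; apply: hx.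
Qed.

End Ideals.

(** * The intersection algebra as a monomial algebra *)

Definition mfun n (a : 'I_n -> nat) : multinom n :=
  Multinom [tuple a i | i < n].

Lemma mfunE n (a : 'I_n -> nat) i : mfun a i = a i.
Proof. by rewrite /mfun multinomE tnth_mktuple. Qed.

Section PowersOfMonomialIdeal.
Variables (k : fieldType) (n : nat) (a : 'I_n -> nat).
Local Notation S := (polyR k n).

Lemma mcoeffM_neq0 (f g : S) c : mcoeff c (f * g) != 0 ->
  exists u v, [/\ c = mnm_add u v, mcoeff u f != 0 & mcoeff v g != 0].
Proof.
rewrite -mcoeff_msupp => /msuppM_le /allpairsP[[u v] /= [hu hv ->]].
by exists u, v; rewrite -!mcoeff_msupp.
Qed.

Definition divisible_by (m : 'I_n -> nat) : set S :=
  [set f | forall c, mcoeff c f != 0 -> forall i, (m i <= c i)%N].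

Lemma divisible_ideal m : is_ideal setT (divisible_by m).
Proof.
split=> //.
- by move=> c; rewrite mcoeff0 eqxx.
- move=> f g hf hg c; rewrite mcoeffD => h i.
  have [f0|] := eqVneq (mcoeff c f) 0; last by move/hf.
  by apply: hg; rewrite f0 add0r in h.
- move=> r f _ hf c /mcoeffM_neq0[u [v [-> _ /hf hv]]] i.
  by rewrite mnmDE (leq_trans (hv i)) // leq_addl.
Qed.

Lemma divisible_prod m r (y : 'I_r -> S) :
  (forall j, divisible_by m (y j)) ->
  divisible_by (fun i => r * m i)%N (\prod_(j < r) y j).
Proof.
elim: r y => [|r IHr] y hy; first by move=> c _ i; rewrite mul0n.
rewrite big_ord_recl => c /mcoeffM_neq0[u [v [-> hu hv]]] i.
rewrite mnmDE mulSn leq_add ?(hy ord0) //.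
by apply: (IHr (fun j => y (lift ord0 j))).
Qed.

Let xa : S := \prod_(i < n) mpolyX k (mnm1 i) ^+ a i.

Lemma monomial_prodE : xa = mpolyX k (mfun a).
Proof.
by rewrite [RHS]mpolyXE_id; apply: eq_bigr => i _; rewrite mfunE.
Qed.

(** A monomial that [x^(r a)] divides is a multiple of the [r]-fold product of
    the generator; conversely divisibility by a monomial is preserved by sums
    and multiples, and adds up in products. *)
Lemma monomial_powE r :
  ideal_pow setT (monomial_ideal k a) r = divisible_by (fun i => r * a i)%N.
Proof.
rewrite eqEsubset; split.
  apply: ideal_gen_min; first exact: divisible_ideal.
  move=> _ [y hy ->]; apply: divisible_prod => j.
  have := hy j; apply: ideal_gen_min; first exact: divisible_ideal.
  move=> _ ->; rewrite -/xa monomial_prodE => c; rewrite mcoeffX.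
  by case: (mfun a =P c) => [<- _ i|_ /eqP//]; rewrite mfunE.
move=> f hf; have idT : is_ideal (@setT S) setT by [].
have [_ I0 ID IM] := ideal_gen_ideal idT (subsetT
  [set x | exists2 y : 'I_r -> S, forall j, monomial_ideal k a (y j) &
     x = \prod_(j < r) y j]).
rewrite (mpolyE f) big_seq; apply: big_ind => // c.
rewrite mcoeff_msupp => /hf hc.
have -> : c = mnm_add (mnm_sub c (mnm_muln (mfun a) r))
                      (mnm_muln (mfun a) r).
  by apply/mnmP => i; rewrite mnmDE mnmBE mulmnE mfunE subnK // mulnC hc.
rewrite mpolyXD -mul_mpolyC mulrA; apply: IM => //.
apply: sub_ideal_gen; exists (fun=> xa).
  by move=> _; apply: sub_ideal_gen.
by rewrite prodr_const card_ord monomial_prodE mpolyXn.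
Qed.

End PowersOfMonomialIdeal.

Section Span.
Variables (k : fieldType) (n : nat).
Local Notation P := (polyRuv k n).

Definition monspan (T : set (expo n)) : set P :=
  [set f | forall w, ecoef w f != 0 -> T w].

Lemma span0 T : monspan T 0.
Proof. by move=> w; rewrite ecoef0 eqxx. Qed.

Lemma spanD T f g : monspan T f -> monspan T g -> monspan T (f + g).
Proof.
move=> hf hg w; rewrite ecoefD => h.
have [f0|/hf//] := eqVneq (ecoef w f) 0.
by apply: hg; rewrite f0 add0r in h.
Qed.

Lemma span_term T (x : k) w : T w -> monspan T (econst n x * mono k w).
Proof.
move=> hw u; rewrite ecoef_constM ecoef_mono.
by case: (w =P u) => [<-|_] //; rewrite mulr0 eqxx.
Qed.

Lemma span_mono T w : T w -> monspan T (mono k w).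
Proof. by move=> hw; rewrite -[mono k w]mul1r -(econst1 k n); apply: span_term. Qed.

Lemma spanM U T V f g : (forall u v, U u -> T v -> V (eadd u v)) ->
  monspan U f -> monspan T g -> monspan V (f * g).
Proof.
by move=> h hf hg w /ecoefM_neq0[u [v [-> /hf hu /hg hv]]]; apply: h.
Qed.

(** How every inclusion of a monomial subspace in an ideal or a submodule is
    checked: on scalar multiples of monomials. *)
Lemma span_ind T (G : set P) : G 0 -> (forall f g, G f -> G g -> G (f + g)) ->
  (forall (x : k) w, T w -> G (econst n x * mono k w)) -> monspan T `<=` G.
Proof.
move=> G0 GD GT f hf; rewrite (polyE f) big_seq.
by apply: big_ind => // w; rewrite mem_esupp => /hf; apply: GT.
Qed.

Lemma span_sub T U : T `<=` U -> monspan T `<=` monspan U.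
Proof. by move=> h f hf w /hf /h. Qed.

Lemma span_ideal (Q T : set (expo n)) : T `<=` Q ->
  (forall u v, Q u -> T v -> T (eadd u v)) -> is_ideal (monspan Q) (monspan T).
Proof.
move=> TQ QT; split; [exact: span_sub|exact: span0|exact: spanD|].
by move=> r x; apply: spanM.
Qed.

End Span.
Arguments monspan k {n} T _.

Section Cone.
Variables (k : fieldType) (n : nat) (a : 'I_n -> nat).
Local Notation P := (polyRuv k n).

Definition cone : set (expo n) :=
  [set w : expo n | forall i b, (a i * w.2 b <= w.1 i)%N].

(** The exponents of the monomials in [m] and, below, in [m^[q]]. *)
Definition max_exp : set (expo n) := [set w | cone w /\ w <> ezero n].

Definition frob_exp (q : nat) : set (expo n) :=
  [set w : expo n | exists z v, [/\ max_exp z, cone v & w = eadd (emul q z) v]].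

Lemma cone0 : cone (ezero n).
Proof. by move=> i b; rewrite mnm0E muln0. Qed.

Lemma coneD u v : cone u -> cone v -> cone (eadd u v).
Proof. by move=> hu hv i b; rewrite !mnmDE mulnDr leq_add. Qed.

Lemma coneM q u : cone u -> cone (emul q u).
Proof. by move=> hu i b; rewrite !mulmnE mulnA leq_mul. Qed.

Lemma max_expD u v : cone u -> max_exp v -> max_exp (eadd u v).
Proof.
move=> hu [hv v0]; split; first exact: coneD.
by rewrite eaddC => /eadd_eq0.
Qed.

Lemma frob_expD q u v : cone u -> frob_exp q v -> frob_exp q (eadd u v).
Proof.
move=> hu [z [v' [hz hv' ->]]]; exists z, (eadd u v'); split=> //.
  exact: coneD.
by rewrite eaddA (eaddC u) -eaddA.
Qed.

Lemma frob_exp_cone q : frob_exp q `<=` cone.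
Proof. by move=> w [z [v [[hz _] hv ->]]]; apply/coneD/hv/coneM. Qed.

Lemma int_algE : int_alg k a a = monspan k cone.
Proof.
apply/seteqP; split=> f hf.
  move=> [c e] h i b; have [] := hf e; rewrite !monomial_powE => h0 h1.
  have hb : b = ord0 \/ b = ord_max.
    by case: b => -[|[|//]] ?; [left|right]; apply/val_inj.
  by rewrite mulnC; case: hb => ->; [apply: h0|apply: h1].
by move=> e; split; rewrite monomial_powE => c h i;
  rewrite mulnC; apply: (hf (c, e)).
Qed.

Lemma span_cone_ideal : is_ideal (monspan k cone) (monspan k cone).
Proof. by apply: span_ideal => //; apply: coneD. Qed.

Lemma max_ideal : is_ideal (monspan k cone) (monspan k max_exp).
Proof. by apply: span_ideal => [w []//|]; apply: max_expD. Qed.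

Lemma frob_ideal q : is_ideal (monspan k cone) (monspan k (frob_exp q)).
Proof. by apply: span_ideal; [apply: frob_exp_cone|apply: frob_expD]. Qed.

Lemma span_maxE (f : P) :
  monspan k max_exp f <-> monspan k cone f /\ ecoef (ezero n) f = 0.
Proof.
split=> [hf|[hf f0] w hw].
  by split=> [w /hf[]//|]; apply: contrapT => /eqP /hf[].
by split; [apply: hf|move=> w0; rewrite w0 f0 eqxx in hw].
Qed.

Lemma int_alg_maxE : int_alg_max k a a = monspan k max_exp.
Proof.
rewrite /int_alg_max int_algE; apply/seteqP; split.
  apply: ideal_gen_min; first exact: max_ideal.
  move=> f [hf f1 [c [e fE]]]; have {}fE : f = mono k (c, e) by [].
  have hw : cone (c, e) by apply: hf; rewrite fE ecoef_mono eqxx oner_neq0.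
  rewrite fE; apply: span_mono; split=> // w0; apply: f1.
  by rewrite fE w0 mono0.
have [|_ I0 ID IM] := ideal_gen_ideal span_cone_ideal
  (G := [set f | [/\ monspan k cone f, f <> 1 & exists c e, f = monomial_uv k c e]]).
  by move=> f [].
apply: span_ind => // x w [hw w0]; apply: IM.
  by rewrite -[econst n x]mulr1 -(mono0 k n); apply: span_term; apply: cone0.
apply: sub_ideal_gen; split; [exact: span_mono| |by exists w.1, w.2].
move/(congr1 (ecoef w)); rewrite -(mono0 k n) !ecoef_mono eqxx.
by case: (ezero n =P w) => [/esym//|_] /eqP; rewrite oner_eq0.
Qed.

(** Frobenius is additive, so the [q]-th power of an element of [m] is a
    combination of [q]-th powers of monomials of [m]. *)
Lemma bracket_powE p e : p \in [pchar k] ->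
  bracket_pow (int_alg k a a) (int_alg_max k a a) (p ^ e) =
    monspan k (frob_exp (p ^ e)).
Proof.
move=> hp; rewrite /bracket_pow int_alg_maxE int_algE; apply/seteqP; split.
  apply: ideal_gen_min; first exact: frob_ideal.
  move=> _ [f hf <-]; rewrite (polyX_Frobenius e f hp) big_seq.
  apply: big_ind; [exact: span0|exact: spanD|] => w; rewrite mem_esupp => /hf hw.
  apply: span_term; exists w, (ezero n); split=> //; first exact: cone0.
  by rewrite eadd0.
have [|_ I0 ID IM] := ideal_gen_ideal span_cone_ideal
  (G := [set f ^+ (p ^ e) | f in monspan k max_exp]).
  move=> _ [f hf <-]; rewrite (polyX_Frobenius e f hp) big_seq.
  apply: big_ind; [exact: span0|exact: spanD|] => w; rewrite mem_esupp.
  by move=> /hf[hw _]; apply: span_term; apply: coneM.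
apply: span_ind => // x _ [z [v [hz hv ->]]].
rewrite eaddC monoD mulrA; apply: IM; first exact: span_term.
by apply: sub_ideal_gen; exists (mono k z); [apply: span_mono|rewrite monoX].
Qed.

End Cone.

(** * Length of the quotient by a monomial ideal *)

Section Length.
Variables (k : fieldType) (n : nat) (Q I : set (expo n)).
Local Notation P := (polyRuv k n).
Hypothesis Q0 : Q (ezero n).
Hypothesis QQ : forall u v, Q u -> Q v -> Q (eadd u v).
Hypothesis IQ : I `<=` Q.
Hypothesis QI : forall u v, Q u -> I v -> I (eadd u v).
Variables (T : finType) (h : T -> expo n).
Hypothesis h_inj : injective h.
Hypothesis hP : forall w, (Q w /\ ~ I w) <-> exists t, w = h t.

Lemma econst_span (x : k) : monspan k Q (econst n x).
Proof. by rewrite -[econst n x]mulr1 -(mono0 k n); apply: span_term. Qed.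

(** Choose [f i] in the [i+1]-st ideal of the chain but not in the [i]-th.  If
    there were more [f i] than exponents outside [I], some nontrivial linear
    combination would vanish outside [I], hence lie in the smallest ideal; its
    last nonzero term would then lie in an ideal that excludes it. *)
Lemma ideal_chain_le l : ideal_chain (monspan k Q) (monspan k I) l -> (l <= #|T|)%N.
Proof.
move=> [C [idC IC CC]]; rewrite leqNgt; apply/negP => ltl.
have Cmon i j : (i <= j)%N -> (j <= l)%N -> C i `<=` C j.
  elim: j => [|j IHj]; first by rewrite leqn0 => /eqP -> _ x.
  rewrite leq_eqVlt => /orP[/eqP -> _ x //|]; rewrite ltnS => lij ljl.
  by exact: (subset_trans (IHj lij (ltnW ljl)) (CC j ljl).1).
have /choice[f hf] (i : 'I_l) : exists g, C i.+1 g /\ ~ C i g.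
  have [_ hn] := CC _ (ltn_ord i); apply: contrapT => hno; apply: hn => g hg.
  by apply: contrapT => hg'; apply: hno; exists g.
pose M := \matrix_(i < l, j < #|T|) ecoef (h (enum_val j)) (f i).
have /rowV0Pn[v /sub_kermxP vM v0] : kermx M != 0.
  rewrite kermx_eq0 /row_free; apply/negP => /eqP rM.
  by have := rank_leq_col M; rewrite rM leqNgt ltl.
pose g := \sum_i econst n (v 0 i) * f i.
have gI : monspan k I g.
  move=> w hw; apply: contrapT => nIw.
  have Qw : Q w.
    move: hw; apply: contraNP => nQ; rewrite ecoef_sum big1 // => i _.
    rewrite ecoef_constM; have [->|] := eqVneq (ecoef w (f i)) 0; rewrite ?mulr0 //.
    by case: (idC i.+1 (ltn_ord i)) => /(_ _ (hf i).1 w) hC _ _ _ /hC /nQ.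
  have /hP[t wE] : Q w /\ ~ I w by [].
  move: hw; apply/negP; rewrite negbK; apply/eqP.
  have := congr1 (fun N : 'rV_#|T| => N 0 (enum_rank t)) vM.
  rewrite !mxE ecoef_sum => {2}<-; apply: eq_bigr => i _.
  by rewrite ecoef_constM !mxE enum_rankK wE.
have [i0 vi0] : exists i, v 0 i != 0.
  apply/existsP; apply: contraR v0 => /existsPn v0; apply/eqP/rowP => i.
  by rewrite mxE; apply/eqP; rewrite -[_ == _]negbK v0.
have [i vi hi] := @arg_maxnP _ i0 (fun i => v 0 i != 0) val vi0.
have lei : (i <= l)%N by apply: ltnW.
have [CB Ci0 CiD CiM] := idC i lei.
case: (hf i) => _; apply.
have -> : f i = econst n (v 0 i)^-1 *
    (g + econst n (-1) * \sum_(j | j != i) econst n (v 0 j) * f j).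
  have -> : econst n (-1) = -1 :> P by rewrite /econst !mpolyCN !mpolyC1.
  by rewrite /g (bigD1 i) //= mulN1r addrK mulrA -econstM mulVf // econst1 mul1r.
apply: (CiM); first exact: econst_span.
apply: (CiD); first exact/(Cmon 0%N i)/IC.
apply: (CiM); first exact: econst_span.
apply: (big_ind (C i)) => // j nij; have [->|vj] := eqVneq (v 0 j) 0.
  by rewrite econst0 mul0r.
apply: (CiM); first exact: econst_span.
have ltji : (j < i)%N by rewrite ltn_neqAle nij; apply: hi.
exact: (Cmon j.+1 i ltji lei _ (hf j).1).
Qed.

Definition edeg (w : expo n) := (mdeg w.1 + mdeg w.2)%N.

Lemma edegD u v : edeg (eadd u v) = (edeg u + edeg v)%N.
Proof. by rewrite /edeg !mdegD addnACA. Qed.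

Lemma edeg_eq0 u : edeg u = 0%N -> u = ezero n.
Proof.
move/eqP; rewrite addn_eq0 !mdeg_eq0 => /andP[/eqP h1 /eqP h2].
by rewrite [u]surjective_pairing h1 h2.
Qed.

(** Adjoin the monomials outside [I] one at a time by decreasing degree: a
    proper multiple of an adjoined monomial has larger degree, so it is in the
    ideal already. *)
Lemma ideal_chain_card : ideal_chain (monspan k Q) (monspan k I) #|T|.
Proof.
pose le (x y : T) := (edeg (h y) <= edeg (h x))%N.
have le_total : total le by move=> x y; apply: leq_total.
have le_trans : transitive le by move=> y x z hxy hyz; apply: leq_trans hyz hxy.
have le_refl : reflexive le by move=> x; apply: leqnn.
pose s := sort le (enum T).
have sT t : t \in s by rewrite mem_sort mem_enum.
have s_uniq : uniq s by rewrite sort_uniq enum_uniq.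
have s_size : size s = #|T| by rewrite size_sort cardE.
have s_sorted : sorted le s by apply: sort_sorted.
have idx t t' : (edeg (h t') < edeg (h t))%N -> (index t s < index t' s)%N.
  move=> lt; rewrite ltnNge leq_eqVlt; apply/negP => /orP[/eqP|].
    by move=> e; rewrite -(nth_index t (sT t')) e nth_index // ltnn in lt.
  move/(sorted_ltn_index le_trans s_sorted _ _ (sT _) (sT _)).
  by rewrite /le leqNgt lt.
pose D i : set (expo n) :=
  [set w | I w \/ exists2 t, w = h t & (index t s < i)%N].
have DQ i : D i `<=` Q.
  by move=> w [/IQ//|[t wE _]]; case: (hP w).2 => //; exists t.
exists (fun i => monspan k (D i)); split.
- move=> i _; apply: span_ideal => // u v Qu [/(QI Qu)|[t {v}-> lt]]; first by left.
  have [Iu|nIu] := pselect (I (eadd u (h t))); first by left.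
  have [u0|u0] := pselect (u = ezero n).
    by right; exists t => //; rewrite u0 eaddC eadd0.
  have Qt : Q (h t) by case: (hP (h t)).2; [exists t|].
  have [t' t'E] := (hP (eadd u (h t))).1 (conj (QQ Qu Qt) nIu).
  right; exists t' => //; apply: leq_trans lt; apply: leqW; apply: idx.
  rewrite -t'E edegD -[X in (X < _)%N]add0n ltn_add2r lt0n.
  by apply/eqP => /edeg_eq0.
- by move=> f hf w /hf Iw; left.
- move=> i; rewrite -s_size => lti; split.
    move=> f hf w /hf[Iw|[t -> lt]]; first by left.
    by right; exists t => //; apply: ltnW.
  have /card_gt0P[t0 _] : (0 < #|T|)%N by rewrite -s_size (leq_ltn_trans _ lti).
  pose t := nth t0 s i; have tI : index t s = i by apply: index_uniq.
  move=> /(_ (mono k (h t))) /(_ _ (h t)); case.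
  + by apply: span_mono; right; exists t => //; rewrite tI.
  + by rewrite ecoef_mono eqxx oner_neq0.
  + by case: (hP (h t)).2; [exists t|].
  + by move=> [t' /h_inj <-]; rewrite tI ltnn.
Qed.

Lemma quotient_length_span (R : realType) :
  quotient_length R (monspan k Q) (monspan k I) = (#|T|%:R)%:E.
Proof.
apply/eqP; rewrite eq_le; apply/andP; split.
  apply: ub_ereal_sup => _ [l hl <-]; rewrite lee_fin ler_nat.
  exact: ideal_chain_le.
by apply: ereal_sup_ubound; exists #|T| => //; apply: ideal_chain_card.
Qed.

End Length.

(** * Exponents of the Frobenius power of the maximal ideal *)

Section ConeOrder.
Variables (n : nat) (a : 'I_n -> nat).

(** The order in which [u <= v] means that [v - u], which need not exist as an
    exponent, lies in the cone: every facet functional is at most as large on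
    [u] as on [v]. *)
Definition fle (u v : expo n) : Prop :=
  (forall b, (u.2 b <= v.2 b)%N) /\
  (forall i b, (u.1 i + a i * v.2 b <= v.1 i + a i * u.2 b)%N).

Lemma fleP u v : fle u v <-> exists2 v', cone a v' & v = eadd u v'.
Proof.
split=> [[h1 h2]|[v' cv' ->]].
  have h3 i : (u.1 i <= v.1 i)%N.
    have := h2 i ord0; have := leq_mul (leqnn (a i)) (h1 ord0); lia.
  exists (mnm_sub v.1 u.1, mnm_sub v.2 u.2).
    move=> i b; rewrite !mnmBE mulnBr; have := h2 i b; have := h3 i.
    by have := leq_mul (leqnn (a i)) (h1 b); lia.
  by apply: expoP => i; rewrite mnmDE mnmBE subnKC.
split=> [b|i b]; rewrite !mnmDE ?leq_addr //.
by have := cv' i b; rewrite mulnDr; lia.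
Qed.

Lemma frob_expP q w : frob_exp a q w <-> exists2 z, max_exp a z & fle (emul q z) w.
Proof.
split=> [[z [v [hz hv ->]]]|[z hz /fleP[v hv ->]]]; last by exists z, v.
by exists z => //; apply/fleP; exists v.
Qed.

Lemma ord2P (b b' c : 'I_2) : b != b' -> c = b \/ c = b'.
Proof.
move=> bb'; have [|cb] := eqVneq c b; [by left|right; apply/val_inj].
by move: b b' c bb' cb => [[|[|?]] ?] [[|[|?]] ?] [[|[|?]] ?].
Qed.

(** The exponents of the generators [x_i], [x^a u] or [x^a v], [x^a u v] of the
    algebra. *)
Definition expX (i : 'I_n) : expo n := (mnm1 i, @mnm0 2).
Definition expU (b : 'I_2) : expo n := (mfun a, mnm1 b).
Definition expUV : expo n := (mfun a, mfun (fun=> 1%N)).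

Lemma expX_max i : max_exp a (expX i).
Proof.
split=> [j b|]; first by rewrite mnm0E muln0.
by move/(congr1 (fun w : expo n => w.1 i)); rewrite /= mnm1E mnm0E eqxx.
Qed.

Lemma expU_max b : max_exp a (expU b).
Proof.
split=> [j c|]; first by rewrite /= mfunE mnm1E; case: eqP; rewrite ?muln1 ?muln0.
by move/(congr1 (fun w : expo n => w.2 b)); rewrite /= mnm1E mnm0E eqxx.
Qed.

Lemma expUV_max : max_exp a expUV.
Proof.
split=> [j c|]; first by rewrite /= !mfunE muln1.
by move/(congr1 (fun w : expo n => w.2 ord0)); rewrite /= mfunE mnm0E.
Qed.

Variable q : nat.

(** The next four lemmas divide by the [q]-th power of one generator:
    [x^a u] or [x^a v] when the exponents of [u] and [v] are at least [q] apart,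
    [x^a u v] when both are at least [q], [x_i] when the excess of the exponent
    of [x_i] is at least [q], and again [x^a u] or [x^a v] when the smaller of
    the two exponents becomes the larger one after the division. *)
Lemma frob_exp_diff w b b' : b != b' -> cone a w -> (w.2 b' + q <= w.2 b)%N ->
  frob_exp a q w.
Proof.
move=> bb' cw h; apply/frob_expP; exists (expU b); first exact: expU_max.
split=> [c|i c]; rewrite !mulmnE !mnm1E ?mfunE; have [->|->] := ord2P c bb'.
- by rewrite eqxx; lia.
- by rewrite (negbTE bb').
- by rewrite eqxx; have := cw i b; lia.
- by rewrite (negbTE bb'); have := cw i b; have := leq_mul (leqnn (a i)) h; lia.
Qed.

Lemma frob_exp_min w : cone a w -> (forall b, q <= w.2 b)%N -> frob_exp a q w.
Proof.
move=> cw h; apply/frob_expP; exists expUV; first exact: expUV_max.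
split=> [c|i c]; rewrite !mulmnE !mfunE; first by rewrite mul1n.
by have := cw i c; lia.
Qed.

Lemma frob_exp_X w i : cone a w -> (forall b, q + a i * w.2 b <= w.1 i)%N ->
  frob_exp a q w.
Proof.
move=> cw h; apply/frob_expP; exists (expX i); first exact: expX_max.
split=> [c|j c]; rewrite !mulmnE !mnm0E // mnm1E.
case: (i =P j) => [<-|_]; first by have := h c; lia.
by have := cw j c; lia.
Qed.

Lemma frob_exp_mid w b b' : b != b' -> cone a w -> (q <= w.2 b)%N ->
  (forall i, a i * (q + w.2 b') <= w.1 i)%N -> frob_exp a q w.
Proof.
move=> bb' cw h1 h2; apply/frob_expP; exists (expU b); first exact: expU_max.
split=> [c|i c]; rewrite !mulmnE !mnm1E ?mfunE; have [->|->] := ord2P c bb'.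
- by rewrite eqxx; lia.
- by rewrite (negbTE bb').
- by rewrite eqxx; have := cw i b; lia.
- by rewrite (negbTE bb'); have := h2 i; lia.
Qed.

(** In the remaining range the divisor [q z] must be as in the last case: [z]
    cannot involve the variable with the smaller exponent, nor consist of [x_i]
    only. *)
Lemma frob_exp_mid_conv w b b' : b != b' -> frob_exp a q w ->
  (w.2 b' < q)%N -> (w.2 b' <= w.2 b)%N -> (w.2 b < w.2 b' + q)%N ->
  (forall i, w.1 i < q + a i * w.2 b)%N ->
  (q <= w.2 b)%N /\ (forall i, a i * (q + w.2 b') <= w.1 i)%N.
Proof.
move=> bb' /frob_expP[z [cz z0] [h1 h2]] m le lt d.
have zb' : z.2 b' = 0%N.
  by have := h1 b'; rewrite mulmnE; case: (z.2 b') => // x; rewrite mulSn; lia.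
have zb : (0 < z.2 b)%N.
  rewrite lt0n; apply/eqP => zb; apply: z0; apply: expoP => j; last first.
    by have [->|->] := ord2P j bb'; rewrite mnm0E.
  rewrite mnm0E; have := h2 j b; rewrite !mulmnE zb muln0 addn0; have := d j.
  by case: (z.1 j) => // x; rewrite mulSn; lia.
split; first by have := h1 b; rewrite mulmnE; have := leq_mul zb (leqnn q); lia.
move=> i; have := h2 i b'; rewrite !mulmnE zb' muln0 addn0.
have := leq_mul (cz i b) (leqnn q).
have := leq_mul (leq_mul (leqnn (a i)) zb) (leqnn q); lia.
Qed.

(** The exponents of the cone on which every facet functional is below [q]. *)
Definition frob_box : set (expo n) := [set w | cone a w /\
  (forall b, w.2 b < q)%N /\ (forall i b, w.1 i < q + a i * w.2 b)%N].

End ConeOrder.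

(** * Counting lattice points *)

Section Parametrization.
Variables (n : nat) (a : 'I_n -> nat) (q : nat).

(** Coordinates of exponents: [(d, (b, s, t))] stands for the exponent where the
    variable [b] among [u, v] has exponent [s + t], the other one has exponent
    [s], and [x_i] has exponent [d i + a i * (s + t)]. *)
Definition box : finType := ({ffun 'I_n -> 'I_q} * ('I_2 * 'I_q * 'I_q))%type.

Definition box_exp (x : box) : expo n :=
  let: (d, (b, s, t)) := x in
  (mfun (fun i => d i + a i * (s + t))%N, mfun (fun c => s + (c == b) * t)%N).

(** When [t = 0] both choices of [b] give the same exponent; one is kept. *)
Definition box_ok (x : box) : bool :=
  let: (d, (b, s, t)) := x in (b == ord_max) ==> (0 < t)%N.

(** The coordinates of the exponents outside [m^[q]], then of those in
    [frob_box]. *)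
Definition hk_box (x : box) : bool :=
  let: (d, (b, s, t)) := x in
  box_ok x && ((s + t < q)%N || [exists i, (d i < a i * (q - t))%N]).

Definition sig_box (x : box) : bool :=
  let: (d, (b, s, t)) := x in
  box_ok x && ((s + t < q)%N && [forall i, (d i + a i * t < q)%N]).

Lemma ord2_other (b : 'I_2) : exists2 b' : 'I_2, b != b' & (b == ord_max) || (b' == ord_max).
Proof.
case: (b =P ord_max) => [->|/eqP bm]; first by exists ord0.
by exists ord_max.
Qed.

Lemma box_exp_inj x y : box_ok x -> box_ok y -> box_exp x = box_exp y -> x = y.
Proof.
case: x y => [d [[b s] t]] [d' [[b' s'] t']] /= ok ok' e.
have e2 c : (s + (c == b) * t = s' + (c == b') * t')%N.
  by have := congr1 (fun w : expo n => w.2 c) e; rewrite /= !mfunE.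
have e1 i : (d i + a i * (s + t) = d' i + a i * (s' + t'))%N.
  by have := congr1 (fun w : expo n => w.1 i) e; rewrite /= !mfunE.
have bb' : b = b'.
  apply/eqP/negP => /negP bb'.
  have := e2 b; have := e2 b'; rewrite !eqxx (negbTE bb') eq_sym (negbTE bb') => h1 h2.
  have t0 : t = 0%N :> nat by lia.
  have t'0 : t' = 0%N :> nat by lia.
  rewrite t0 implybF in ok; rewrite t'0 implybF in ok'.
  by have [h|h] := ord2P ord_max bb'; rewrite -h eqxx in ok ok'.
have [c /negbTE bc _] := ord2_other b.
have := e2 b; have := e2 c; rewrite -bb' eqxx eq_sym bc !mul0n !mul1n !addn0 => h1 h2.
have h3 : t = t' :> nat by lia.
have -> : d = d'.
  by apply/ffunP => i; apply/val_inj; have := e1 i; rewrite /= h1 h3 => /addIn.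
by rewrite bb' (val_inj h1) (val_inj h3).
Qed.

Lemma box_exp_surj (w : expo n) (b b' : 'I_2) : b != b' -> cone a w ->
  ((b == ord_max) + w.2 b' <= w.2 b)%N ->
  (w.2 b' < q)%N -> (w.2 b < w.2 b' + q)%N ->
  (forall i, w.1 i < q + a i * w.2 b)%N ->
  exists (d : {ffun 'I_n -> 'I_q}) (s t : 'I_q),
    [/\ box_ok (d, (b, s, t)), w = box_exp (d, (b, s, t)),
        s = w.2 b' :> nat, (s + t)%N = w.2 b :> nat &
        forall i, (d i + a i * w.2 b)%N = w.1 i].
Proof.
move=> bb' cw hle hs ht hd.
have ltd i : (w.1 i - a i * w.2 b < q)%N by have := hd i; have := cw i b; lia.
have ltt : (w.2 b - w.2 b' < q)%N by lia.
exists [ffun i => Ordinal (ltd i)], (Ordinal hs), (Ordinal ltt).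
have hst : (w.2 b' + (w.2 b - w.2 b'))%N = w.2 b by lia.
split=> //=.
- by case: eqP hle => //= _; lia.
- apply: expoP => [i|c]; rewrite mfunE ?ffunE /=.
    by rewrite hst subnK.
  have [->|->] := ord2P c bb'; rewrite ?eqxx ?mul1n //.
  by rewrite eq_sym (negbTE bb') mul0n addn0.
- by move=> i; rewrite ffunE /= subnK.
Qed.

Lemma cone_box x : cone a (box_exp x).
Proof.
case: x => [d [[b s] t]] i c; rewrite /= !mfunE.
by rewrite (leq_trans _ (leq_addl _ _)) // leq_mul //; case: eqP; lia.
Qed.

Lemma exponents_ordered (w : expo n) :
  exists b b' : 'I_2, b != b' /\ ((b == ord_max) + w.2 b' <= w.2 b)%N.
Proof.
have [h|h] := leqP (w.2 ord_max) (w.2 ord0).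
  by exists ord0, ord_max; split.
by exists ord_max, ord0; split.
Qed.

Lemma hk_boxP (w : expo n) :
  (cone a w /\ ~ frob_exp a q w) <-> exists x : {x : box | hk_box x}, w = box_exp (val x).
Proof.
split=> [[cw nw]|[[x hx] /= ->]]; last first.
  split; first exact: cone_box.
  case: x hx => [d [[b s] t]] hx; set v := box_exp _ => fv.
  have [b' bb' _] := ord2_other b.
  have hb : v.2 b = (s + t)%N by rewrite /= mfunE eqxx mul1n.
  have hb' : v.2 b' = s by rewrite /= mfunE eq_sym (negbTE bb') addn0.
  have hd i : v.1 i = (d i + a i * (s + t))%N by rewrite /= mfunE.
  have [||||] := frob_exp_mid_conv bb' fv; rewrite ?hb ?hb'.
  - exact: ltn_ord.
  - exact: leq_addr.
  - by rewrite ltn_add2l ltn_ord.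
  - by move=> i; rewrite hd ltn_add2r.
  - move=> h1 h2; move: hx => /andP[_]; rewrite ltnNge h1 /= => /existsP[i].
    rewrite ltnNge; case/negP; have := h2 i; rewrite hd.
    rewrite mulnBr !mulnDr; move: (a i * q)%N (a i * s)%N (a i * t)%N.
    by move: (nat_of_ord (d i)); clear; lia.
have [b [b' [bb' hle]]] := exponents_ordered w.
have hle' : (w.2 b' <= w.2 b)%N by apply: leq_trans hle; apply: leq_addl.
have hs : (w.2 b' < q)%N.
  rewrite ltnNge; apply/negP => h; apply: nw; apply: frob_exp_min => // c.
  by have [->|->] := ord2P c bb'; lia.
have ht : (w.2 b < w.2 b' + q)%N.
  by rewrite ltnNge; apply/negP => h; apply: nw; apply: (frob_exp_diff bb').
have hd i : (w.1 i < q + a i * w.2 b)%N.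
  rewrite ltnNge; apply/negP => h; apply: nw; apply: (frob_exp_X (i := i)) => // c.
  have [->|->] := ord2P c bb'; first exact: h.
  by have := leq_mul (leqnn (a i)) hle'; lia.
have [d [s [t [ok wE es est ed]]]] := box_exp_surj bb' cw hle hs ht hd.
suff hx : hk_box (d, (b, s, t)) by exists (exist _ (d, (b, s, t)) hx).
rewrite /hk_box ok /= est; have [//|/= lq] := ltnP.
rewrite -[X in is_true X]negbK negb_exists; apply/negP => /forallP h.
apply: nw; apply: (frob_exp_mid bb') => [//|//|i].
have := h i; rewrite -leqNgt -ed -es -est mulnBr !mulnDr.
move: (a i * q)%N (a i * s)%N (a i * t)%N.
by move: (nat_of_ord (d i)); clear; lia.
Qed.

Lemma sig_boxP (w : expo n) :
  frob_box a q w <-> exists x : {x : box | sig_box x}, w = box_exp (val x).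
Proof.
split=> [[cw [h1 h2]]|[[x hx] /= ->]]; last first.
  split; first exact: cone_box.
  case: x hx => [d [[b s] t]] /= /andP[_ /andP[st /forallP h]].
  split=> [c|i c]; rewrite !mfunE; first by case: eqP; lia.
  by have := h i; rewrite !mulnDr; case: eqP; lia.
have [b [b' [bb' hle]]] := exponents_ordered w.
have ht : (w.2 b < w.2 b' + q)%N by have := h1 b; lia.
have [d [s [t [ok wE es est ed]]]] :=
  box_exp_surj bb' cw hle (h1 b') ht (fun i => h2 i b).
suff hx : sig_box (d, (b, s, t)) by exists (exist _ (d, (b, s, t)) hx).
rewrite /sig_box ok /= est h1 /=; apply/forallP => i.
by have := h2 i b'; rewrite -ed -est -es mulnDr; lia.
Qed.

Lemma card_boxE (A : pred box) :
  #|A| = (\sum_(b < 2) \sum_(s < q) \sum_(t < q) #|[pred d | A (d, (b, s, t))]|)%N.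
Proof.
rewrite pair_bigA pair_bigA /= -sum1_card.
transitivity (\sum_(x : {ffun 'I_n -> 'I_q}) \sum_(y : 'I_2 * 'I_q * 'I_q) A (x, y))%N.
  by rewrite pair_bigA big_mkcond; apply: eq_bigr => -[x y] _; rewrite unfold_in; case: (A _).
rewrite exchange_big; apply: eq_bigr => -[[b s] t] _ /=.
by rewrite -sum1_card [RHS]big_mkcond.
Qed.

Lemma sum_ord_geq m : (\sum_(x < q) (m <= x) = q - m)%N.
Proof.
by elim: q => [|r IHr]; rewrite ?big_ord0 ?big_ord_recr //= IHr; case: leqP; lia.
Qed.

Lemma sum_ord_addlt m : (\sum_(x < q) (x + m < q) = q - m)%N.
Proof.
rewrite -sum_ord_geq (reindex_inj rev_ord_inj); apply: eq_bigr => x _ /=.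
by have lt := ltn_ord x; congr (nat_of_bool _); lia.
Qed.

Lemma card_ffun_forall (F : 'I_n -> pred 'I_q) :
  (#|[pred d : {ffun 'I_n -> 'I_q} | [forall i, F i (d i)]]| =
   \prod_i \sum_(x < q) F i x)%N.
Proof.
have -> : #|[pred d : {ffun 'I_n -> 'I_q} | [forall i, F i (d i)]]| =
    #|family F| by apply: eq_card.
rewrite card_family foldrE big_map big_enum; apply: eq_bigr => i _.
by rewrite -sum1_card big_mkcond; apply: eq_bigr => x _; rewrite unfold_in; case: (F i x).
Qed.

(** The number of [d] in the cube [0, q)^n with [d i + a i * t < q] for all [i]. *)
Definition corner (t : nat) := (\prod_i (q - a i * t))%N.

Lemma corner0 : corner 0 = (q ^ n)%N.
Proof.
rewrite /corner -[n in RHS]card_ord -prod_nat_const.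
by apply: eq_bigr => i _; rewrite muln0 subn0.
Qed.

Lemma corner_le t : (corner t <= q ^ n)%N.
Proof.
rewrite -corner0; apply: leq_prod => i _.
by rewrite muln0 subn0 leq_subr.
Qed.

Lemma card_sig_cube b s t :
  (#|[pred d | sig_box (d, (b, s, t))]| =
   ((b == ord_max) ==> (0 < t)) * ((s + t < q) * corner t))%N.
Proof.
have [ok|nok] := boolP ((b == ord_max) ==> (0 < t)%N); last first.
  by rewrite mul0n; apply: eq_card0 => d; rewrite inE /= (negbTE nok).
have [st|st] := boolP (s + t < q)%N; last first.
  by rewrite mul0n; apply: eq_card0 => d; rewrite inE /= (negbTE st) andbF.
have -> : corner t = (\prod_i \sum_(x < q) (x + a i * t < q))%N.
  by apply: eq_bigr => i _; rewrite sum_ord_addlt.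
rewrite !mul1n.
rewrite -(card_ffun_forall (fun i x => x + a i * t < q)%N).
by apply: eq_card => d; rewrite !inE /= ok st.
Qed.

Lemma card_hk_cube b s t :
  (#|[pred d | hk_box (d, (b, s, t))]| =
   ((b == ord_max) ==> (0 < t)) * (q ^ n - (q - t <= s) * corner (q - t)))%N.
Proof.
have [ok|nok] := boolP ((b == ord_max) ==> (0 < t)%N); last first.
  by rewrite mul0n; apply: eq_card0 => d; rewrite inE /= (negbTE nok).
have cube : #|{ffun 'I_n -> 'I_q}| = (q ^ n)%N by rewrite card_ffun !card_ord.
rewrite mul1n; have -> : (q - t <= s)%N = ~~ (s + t < q)%N by lia.
have [st|st] := boolP (s + t < q)%N => /=.
  by rewrite mul0n subn0 -cube; apply: eq_card => d; rewrite !inE /= ok st.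
have -> : corner (q - t) = (\prod_i \sum_(x < q) (a i * (q - t) <= x))%N.
  by apply: eq_bigr => i _; rewrite sum_ord_geq.
rewrite mul1n.
rewrite -(card_ffun_forall (fun i x => a i * (q - t) <= x)%N) -cube.
rewrite -(cardC [pred d : {ffun 'I_n -> 'I_q} |
  [forall i, (a i * (q - t) <= d i)%N]]) addKn.
apply: eq_card => d; rewrite !inE /= ok (negbTE st) /= negb_forall.
by apply: eq_existsb => i; rewrite ltnNge.
Qed.

(** Every pair with [t > 0] occurs for both values of [b], those with [t = 0]
    once. *)
Lemma sum_box (f : nat -> nat -> nat) :
  (\sum_(b < 2) \sum_(s < q) \sum_(t < q)
      ((b == ord_max) ==> (0 < t)) * f s t + \sum_(s < q) f s 0 =
   2 * \sum_(s < q) \sum_(t < q) f s t)%N.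
Proof.
rewrite !big_ord_recl big_ord0 addn0 -addnA mul2n -addnn; congr (_ + _)%N.
  by apply: eq_bigr => s _; apply: eq_bigr => t _; rewrite mul1n.
rewrite -big_split; apply: eq_bigr => s _ /=.
case: q s => [[]//|r] s; rewrite !big_ord_recl /= addnC; congr (_ + _)%N.
by apply: eq_bigr => t _; rewrite mul1n.
Qed.

Lemma sum_corner_rev :
  (\sum_(t < q) t * corner (q - t) + q ^ n.+1 = \sum_(t < q) (q - t) * corner t)%N.
Proof.
rewrite expnS -corner0 /corner; case: q => [|r]; first by rewrite !big_ord0.
rewrite !big_ord_recl mul0n add0n addnC /=; congr (_ + _)%N.
rewrite (reindex_inj rev_ord_inj); apply: eq_bigr => t _ /=.
by rewrite /bump !add1n; have lt := ltn_ord t; congr (_ * _)%N; [lia|];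
  apply: eq_bigr => i _; congr (_ - _ * _)%N; lia.
Qed.

Lemma card_sig_box :
  (#|[pred x | sig_box x]| + q ^ n.+1 = 2 * \sum_(t < q) (q - t) * corner t)%N.
Proof.
rewrite card_boxE.
under eq_bigr => b _ do under eq_bigr => s _ do
  under eq_bigr => t _ do rewrite card_sig_cube.
have -> : (q ^ n.+1 = \sum_(s < q) (s + 0 < q) * corner 0)%N.
  by rewrite -big_distrl /= sum_ord_addlt subn0 corner0 expnS.
rewrite (sum_box (fun s t => (s + t < q) * corner t)%N) exchange_big; congr (_ * _)%N.
by apply: eq_bigr => t _; rewrite -big_distrl /= sum_ord_addlt.
Qed.

(** What the second condition of [hk_box] removes is, after the reflection
    [sum_corner_rev] of [t] in [q - t], as large as the part of [sig_box] with
    [t > 0]. *)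
Lemma card_hk_box :
  (#|[pred x | hk_box x]| + #|[pred x | sig_box x]| = 2 * q ^ n.+2)%N.
Proof.
apply/eqP; rewrite -(eqn_add2r (2 * q ^ n.+1)) mul2n -addnn addnACA card_sig_box.
rewrite -sum_corner_rev card_boxE.
under eq_bigr => b _ do under eq_bigr => s _ do
  under eq_bigr => t _ do rewrite card_hk_cube.
have -> : (q ^ n.+1 = \sum_(s < q) (q ^ n - (q - 0 <= s) * corner (q - 0)))%N.
  under eq_bigr => s _ do rewrite subn0 leqNgt ltn_ord mul0n subn0.
  by rewrite sum_nat_const card_ord expnS.
rewrite (sum_box (fun s t => q ^ n - (q - t <= s) * corner (q - t))%N).
set X := (\sum_(s < q) \sum_(t < q) _)%N; set K := (\sum_(t < q) _)%N.
have XK : (X + K = q ^ n.+2)%N.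
  have -> : K = (\sum_(s < q) \sum_(t < q) (q - t <= s) * corner (q - t))%N.
    rewrite exchange_big; apply: eq_bigr => t _.
    by rewrite -big_distrl /= sum_ord_geq subKn // ltnW.
  have -> : (q ^ n.+2 = \sum_(s < q) \sum_(t < q) q ^ n)%N.
    by rewrite !sum_nat_const !card_ord !expnS.
  rewrite -big_split /=; apply: eq_bigr => s _; rewrite -big_split /=.
  apply: eq_bigr => t _; apply: subnK.
  by rewrite (leq_trans _ (corner_le (q - t))) // -[leqRHS]mul1n leq_mul // leq_b1.
by apply/eqP; rewrite -XK; lia.
Qed.

End Parametrization.

Section HilbertKunzLength.
Variables (k : fieldType) (n : nat) (a : 'I_n -> nat).

Lemma HK_length (R : realType) p e : p \in [pchar k] ->
  quotient_length R (int_alg k a a)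
    (bracket_pow (int_alg k a a) (int_alg_max k a a) (p ^ e)) =
  (#|[pred x | hk_box a (q := p ^ e) x]|%:R)%:E.
Proof.
move=> hp; rewrite bracket_powE // int_algE.
rewrite (@quotient_length_span _ _ _ _ _ _ _ _ {x : box n (p ^ e) | hk_box a x}
  (fun x => box_exp a (val x))).
- by rewrite card_sig.
- exact: cone0.
- exact: coneD.
- exact: frob_exp_cone.
- exact: frob_expD.
- move=> [x hx] [y hy] /= h; apply/val_inj/(@box_exp_inj _ a) => //=.
    by case: x hx {h} => d [[b s] t] /andP[].
  by case: y hy {h} => d [[b s] t] /andP[].
- exact: hk_boxP.
Qed.

End HilbertKunzLength.

(** * Congruences modulo q in the cone *)

Section FrobeniusBox.
Variables (n : nat) (a : 'I_n -> nat).

Lemma fle_anti u v : fle a u v -> fle a v u -> u = v.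
Proof.
move=> /fleP[x _ vE] /fleP[y _ uE].
have : eadd x y = ezero n.
  by apply: (@eaddI _ u); rewrite eadd0 eaddA -vE -uE.
by move/eadd_eq0 => x0; rewrite vE x0 eadd0.
Qed.

Variable q : nat.

(** A facet functional takes a value below [q] on [s] and a nonnegative one on
    [w], so the difference of its values on [v] and [u] exceeds [-1]. *)
Lemma frob_box_cancel w s u v : cone a w -> frob_box a q s ->
  eadd w (emul q u) = eadd s (emul q v) -> fle a u v.
Proof.
move=> cw [cs [s2 s1]] e.
have e2 b : (w.2 b + u.2 b * q = s.2 b + v.2 b * q)%N.
  by have := congr1 (fun w : expo n => w.2 b) e; rewrite !mnmDE !mulmnE.
have e1 i : (w.1 i + u.1 i * q = s.1 i + v.1 i * q)%N.
  by have := congr1 (fun w : expo n => w.1 i) e; rewrite !mnmDE !mulmnE.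
split=> [b|i b]; rewrite leqNgt; apply/negP => lt.
  by have := e2 b; have := s2 b; have := leq_mul lt (leqnn q); rewrite mulSn; lia.
have := leq_mul lt (leqnn q); rewrite mulSn !mulnDl => lt'.
have h1 : ((w.1 i + u.1 i * q) + a i * (s.2 b + v.2 b * q) =
           (s.1 i + v.1 i * q) + a i * (w.2 b + u.2 b * q))%N by rewrite e1 e2.
have := s1 i b; have := cw i b; move: lt' h1; rewrite !mulnDr !mulnA.
move: (a i * _ * q)%N (a i * _ * q)%N (w.1 i) (s.1 i) (u.1 i * q)%N (v.1 i * q)%N.
by move: (a i * s.2 b)%N (a i * w.2 b)%N; clear; lia.
Qed.

Hypothesis a_gt0 : forall i, (0 < a i)%N.

(** Along a facet on which [w] has value at least [q], an element [z] of value 1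
    and an element [y] of value 0 that dominates [z] on all other facets. *)
Lemma not_frob_box w : cone a w -> ~ frob_box a q w -> exists y z,
  [/\ cone a y, cone a z, ~ fle a z y & fle a (emul q z) (eadd w (emul q y))].
Proof.
move=> cw nw.
have [[b hb]|nb] := pselect (exists b, (q <= w.2 b)%N).
  exists (mfun a, @mnm0 2), (expU a b); split.
  - by move=> i c; rewrite /= mnm0E muln0.
  - exact: (expU_max a b).1.
  - by move=> [/(_ b)]; rewrite /= mnm1E eqxx mnm0E.
  - split=> [c|i c]; rewrite !mnmDE !mulmnE mnm0E mnm1E.
      by case: eqP => [<-|]; lia.
    by rewrite /= !mfunE addn0; have := cw i c; lia.
have [[i [b hb]]|nib] := pselect (exists i b, (q + a i * w.2 b <= w.1 i)%N).
  exists (expU a b), (expX i); split.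
  - exact: (expU_max a b).1.
  - exact: (expX_max a i).1.
  - by move=> [_ /(_ i b)]; rewrite /= !mnm1E !eqxx mnm0E mfunE; lia.
  - split=> [c|j c]; rewrite !mnmDE !mulmnE mnm0E mnm1E ?mul0n //.
    rewrite /= mnm1E mfunE muln0 addn0 mulnDr.
    have [<-|ij] := eqVneq i j; have [<-|bc] := eqVneq b c.
    + by move: hb; lia.
    + by have := cw i c; have := leq_mul (a_gt0 i) (leqnn q); lia.
    + by have := cw j b; lia.
    + by have := cw j c; lia.
case: nw; split=> //; split=> [b|i b]; rewrite ltnNge; apply/negP => h.
  by apply: nb; exists b.
by apply: nib; exists i, b.
Qed.

End FrobeniusBox.

(** * Bases of the coefficient field over its Frobenius images *)

Section FrobeniusBasis.
Variables (k : fieldType) (p D : nat).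
Hypothesis hp : p \in [pchar k].

Definition frob_basis (q : nat) (Om : finType) (om : Om -> k) : Prop :=
  (forall x, exists c : Om -> k, x = \sum_i c i ^+ q * om i) /\
  (forall c : Om -> k, \sum_i c i ^+ q * om i = 0 -> forall i, c i = 0).

Lemma frob_degree_basis : frob_degree k p D ->
  exists w : 'I_D -> k, frob_basis p w.
Proof.
have p_gt0 : (0 < p)%N by rewrite prime_gt0 // (pcharf_prime hp).
move=> [w hw]; exists w; split=> [x|c c0 i].
  have [r [[hr ->] _]] := hw x.
  have /choice[s hs] i : exists y, y ^+ p = r i by have [y _ ?] := hr i; exists y.
  by exists s; apply: eq_bigr => i _; rewrite hs.
have [r [_ ru]] := hw 0.
have r1 := ru [ffun i => c i ^+ p]; have r2 := ru [ffun=> 0].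
have e : [ffun i => c i ^+ p] = [ffun=> 0] :> {ffun 'I_D -> k}.
  rewrite -r1 ?r2 //; split=> [j|].
  - by rewrite ffunE; exists 0 => //; rewrite expr0n eqn0Ngt p_gt0.
  - by rewrite big1 // => j _; rewrite ffunE mul0r.
  - by rewrite ffunE; exists (c j).
  - by rewrite -[LHS]c0; apply: eq_bigr => j _; rewrite ffunE.
by have /ffunP/(_ i) := e; rewrite !ffunE => /eqP; rewrite expf_eq0 => /andP[_ /eqP].
Qed.

(** If [w] is a basis over [k^p] and [om] one over [k^(p^e)], then the [om^p]
    form a basis of [k^p] over [k^(p^(e+1))], and the products [om^p w] a basis
    of [k]. *)
Lemma frob_basis_iter : frob_degree k p D -> forall e,
  exists (Om : finType) (om : Om -> k), #|Om| = (D ^ e)%N /\ frob_basis (p ^ e) om.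
Proof.
move=> /frob_degree_basis[w [w_span w_free]]; elim=> [|e [Om [om [cardOm [om_span om_free]]]]].
  exists 'I_1, (fun=> 1); rewrite card_ord; split=> //; split.
    by move=> x; exists (fun=> x); rewrite big_ord1 expr1 mulr1.
  by move=> c; rewrite big_ord1 expr1 mulr1 => c0 i; rewrite ord1.
have pp (I : Type) (s : seq I) (F : I -> k) : (\sum_(i <- s) F i) ^+ p = \sum_(i <- s) F i ^+ p.
  by have := Frobenius_sum 1 s F hp; rewrite expn1.
have sumE (c : Om * 'I_D -> k) :
    \sum_x c x ^+ (p ^ e.+1) * (om x.1 ^+ p * w x.2) =
    \sum_i (\sum_b c (b, i) ^+ (p ^ e) * om b) ^+ p * w i.
  transitivity (\sum_b \sum_i c (b, i) ^+ (p ^ e.+1) * (om b ^+ p * w i)).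
    by rewrite pair_bigA; apply: eq_bigr => -[].
  rewrite exchange_big; apply: eq_bigr => i _; rewrite pp mulr_suml.
  by apply: eq_bigr => b _; rewrite exprMn -exprM -expnSr mulrA.
exists (Om * 'I_D)%type, (fun x => om x.1 ^+ p * w x.2); split.
  by rewrite card_prod card_ord cardOm expnSr.
split=> [x|c]; last first.
  by rewrite sumE => /w_free h [b i]; apply: (om_free _ (h i) b).
have [y ->] := w_span x.
have /choice[c hc] i := om_span (y i).
exists (fun x => c x.2 x.1); rewrite sumE /=.
by apply: eq_bigr => i _; rewrite -hc.
Qed.

End FrobeniusBasis.

(** * The local ring at the maximal monomial ideal *)

Section Localization.
Variables (k : fieldType) (n : nat) (a : 'I_n -> nat).
Local Notation P := (polyRuv k n).
Local Notation B := (monspan k (cone a)).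
Local Notation F := {fraction P}.
Local Notation L := (localization B (monspan k (max_exp a))).
Local Notation tof := (@FracField.tofrac P).

(** The denominators of the local ring. *)
Definition unit0 (g : P) : Prop := B g /\ ecoef (ezero n) g != 0.

Lemma unit0_neq0 g : unit0 g -> tof g != 0.
Proof.
move=> [_ g0]; rewrite tofrac_eq0; apply: contra_neq g0 => ->.
exact: ecoef0.
Qed.

Lemma unit0M g h : unit0 g -> unit0 h -> unit0 (g * h).
Proof.
move=> [gB g0] [hB h0]; split; last by rewrite ecoef0M mulf_neq0.
exact: (spanM (@coneD n a) gB hB).
Qed.

Lemma unit01 : unit0 1.
Proof.
split; last by rewrite ecoef0_1 oner_neq0.
by rewrite -(mono0 k n); apply: span_mono; apply: cone0.
Qed.

Lemma unit0X g q : unit0 g -> unit0 (g ^+ q).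
Proof.
by move=> hg; elim: q => [|q IHq]; [apply: unit01|rewrite exprS; apply: unit0M].
Qed.

Lemma spanX g q : B g -> B (g ^+ q).
Proof.
move=> hg; elim: q => [|q IHq]; first exact: unit01.1.
by rewrite exprS; apply: (spanM (@coneD n a)).
Qed.

Lemma locP x : L x <-> exists f g, [/\ B f, unit0 g & x = tof f / tof g].
Proof.
split=> -[f [g]].
  move=> [hf hg ng ->]; exists f, g; split=> //; split=> //.
  by apply: contra_notN ng => /eqP g0; apply/span_maxE.
move=> [hf [hg g0] ->]; exists f, g; split=> //.
by case/span_maxE => _ /eqP; rewrite (negbTE g0).
Qed.

Lemma loc_tof f : B f -> L (tof f).
Proof.
by move=> hf; apply/locP; exists f, 1; split=> //; [apply: unit01|rewrite rmorph1 divr1].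
Qed.

Lemma locD x y : L x -> L y -> L (x + y).
Proof.
move=> /locP[f [g [hf hg ->]]] /locP[f' [g' [hf' hg' ->]]]; apply/locP.
exists (f * g' + f' * g), (g * g'); split.
- by apply: spanD; apply: (spanM (@coneD n a)) => //; [case: hg'|case: hg].
- exact: unit0M.
- by rewrite addf_div ?unit0_neq0 // !rmorphD !rmorphM.
Qed.

Lemma locM x y : L x -> L y -> L (x * y).
Proof.
move=> /locP[f [g [hf hg ->]]] /locP[f' [g' [hf' hg' ->]]]; apply/locP.
exists (f * f'), (g * g'); split.
- by apply: (spanM (@coneD n a)).
- exact: unit0M.
- by rewrite mulf_div !rmorphM.
Qed.

Lemma loc0 : L 0.
Proof. by rewrite -(rmorph0 tof); apply: loc_tof; apply: span0. Qed.

Lemma loc_common_denom (I : finType) (x : I -> F) : (forall i, L (x i)) ->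
  exists g (f : I -> P), unit0 g /\ forall i, B (f i) /\ x i = tof (f i) / tof g.
Proof.
move=> /(_ _)/locP-/choice[f /choice[g hfg]].
exists (\prod_i g i), (fun i => f i * \prod_(j | j != i) g j); split.
  apply: (big_ind unit0); [exact: unit01|exact: unit0M|].
  by move=> i _; case: (hfg i).
move=> i; have [hf hg ->] := hfg i; split.
  apply: (spanM (@coneD n a)) => //.
  apply: (big_ind B); first exact: unit01.1.
    by move=> ? ?; apply: (spanM (@coneD n a)).
  by move=> j _; case: (hfg j) => _ [].
have -> : \prod_j g j = g i * \prod_(j | j != i) g j by rewrite (bigD1 i).
rewrite !rmorphM -mulf_div divff ?mulr1 //.
rewrite rmorph_prod; apply/prodf_neq0 => j _; apply: unit0_neq0.
by case: (hfg j).
Qed.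

(** The image of [x] in the residue field [k] of the local ring. *)
Definition residue (x : F) : k :=
  xget 0 [set l | exists f g, [/\ ecoef (ezero n) g != 0, x = tof f / tof g &
                                  l = ecoef (ezero n) f / ecoef (ezero n) g]].

Lemma residueE f g : ecoef (ezero n) g != 0 ->
  residue (tof f / tof g) = ecoef (ezero n) f / ecoef (ezero n) g.
Proof.
move=> g0; rewrite /residue; case: xgetP => [l _|] //; last first.
  by move=> /(_ (ecoef (ezero n) f / ecoef (ezero n) g)); case; exists f, g.
move=> [f' [g' [g'0 e ->]]].
have nz (h : P) : ecoef (ezero n) h != 0 -> tof h != 0.
  by move=> h0; rewrite tofrac_eq0; apply: contra_neq h0 => ->; apply: ecoef0.
move/eqP: e; rewrite eqr_div ?nz // -!rmorphM tofrac_eq => /eqP.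
move/(congr1 (ecoef (ezero n))); rewrite !ecoef0M => e.
by apply/eqP; rewrite eqr_div // e.
Qed.

Lemma residueD x y : L x -> L y -> residue (x + y) = residue x + residue y.
Proof.
move=> /locP[f [g [_ hg ->]]] /locP[f' [g' [_ hg' ->]]].
rewrite addf_div ?unit0_neq0 // -!rmorphM -rmorphD !residueE ?hg.2 ?hg'.2 //; last first.
  by rewrite ecoef0M mulf_neq0 ?hg.2 ?hg'.2.
by rewrite ecoefD !ecoef0M addf_div ?hg.2 ?hg'.2.
Qed.

Lemma residueM x y : L x -> L y -> residue (x * y) = residue x * residue y.
Proof.
move=> /locP[f [g [_ hg ->]]] /locP[f' [g' [_ hg' ->]]].
rewrite mulf_div -!rmorphM !residueE ?hg.2 ?hg'.2 //; last first.
  by rewrite ecoef0M mulf_neq0 ?hg.2 ?hg'.2.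
by rewrite !ecoef0M mulf_div.
Qed.

Lemma residue_tof f : residue (tof f) = ecoef (ezero n) f.
Proof.
by rewrite -[tof f]divr1 -(rmorph1 tof) residueE ecoef0_1 ?divr1 ?oner_neq0.
Qed.

End Localization.

(** * The free summand spanned by the Frobenius box *)

Lemma frob_free_fintype (A : comNzRingType) (B M : set A) (q : nat) (I : finType)
    (w : I -> A) : (forall i, M (w i)) ->
  (forall x, M x -> exists r : I -> A,
     (forall i, B (r i)) /\ x = \sum_i r i ^+ q * w i) ->
  (forall r r' : I -> A, (forall i, B (r i)) -> (forall i, B (r' i)) ->
     \sum_i r i ^+ q * w i = \sum_i r' i ^+ q * w i -> r =1 r') ->
  frob_free B q M #|I|.
Proof.
move=> wM gen indep; exists (fun j => w (enum_val j)) => // x /gen[r [rB xE]].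
have sumE (s : {ffun 'I_#|I| -> A}) :
    \sum_j s j ^+ q * w (enum_val j) = \sum_i s (enum_rank i) ^+ q * w i.
  rewrite (reindex_onto enum_rank enum_val) => [|j _]; last exact: enum_valK.
  by apply: eq_big => i; rewrite enum_rankK ?eqxx.
exists [ffun j => r (enum_val j)]; split.
  split=> [j|]; first by rewrite ffunE.
  by rewrite sumE xE; apply: eq_bigr => i _; rewrite ffunE enum_rankK.
move=> s [sB]; rewrite sumE xE => e; apply/ffunP => j; rewrite ffunE.
have := indep r (fun i => s (enum_rank i)) rB (fun i => sB _) e (enum_val j).
by rewrite enum_valK.
Qed.

Section FreeSummand.
Variables (k : fieldType) (n : nat) (a : 'I_n -> nat) (p e : nat).
Hypothesis hp : p \in [pchar k].
Variable q : nat.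
Hypothesis qE : q = (p ^ e)%N.
Variables (Om : finType) (om : Om -> k).
Hypothesis om_basis : frob_basis q om.
Variables (T : finType) (W : T -> expo n).
Hypothesis W_inj : injective W.
Hypothesis WP : forall w, frob_box a q w <-> exists t, w = W t.
Local Notation P := (polyRuv k n).
Local Notation B := (monspan k (cone a)).
Local Notation F := {fraction P}.
Local Notation L := (localization B (monspan k (max_exp a))).
Local Notation tof := (@FracField.tofrac P).
Local Notation unit0 := (@unit0 k n a).

Let hP : p \in [pchar P] := pchar_polyRuv n hp.

Lemma pchar_frac : p \in [pchar F].
Proof. exact: (rmorph_pchar (tof : {rmorphism _ -> _}) hP). Qed.

Lemma q_gt0 : (0 < q)%N.
Proof. by rewrite qE expn_gt0 prime_gt0 // (pcharf_prime hp). Qed.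

(** Denominators that are [q]-th powers act on the Frobenius pushforward as
    scalars, so that decompositions of [B] carry over to the local ring. *)
Lemma loc_pow_denom x : L x -> exists f g, [/\ B f, unit0 g & x = tof f / tof g ^+ q].
Proof.
move=> /locP[f [g [hf hg ->]]]; exists (f * g ^+ q.-1), g; split=> //.
  by apply: (spanM (@coneD n a)) => //; apply: spanX; case: hg.
rewrite rmorphM rmorphXn -[in RHS](prednK q_gt0) exprS -mulf_div.
by rewrite divff ?mulr1 //; apply: expf_neq0; apply: (unit0_neq0 hg).
Qed.

Lemma unit0_pow_neq0 g : unit0 g -> tof g ^+ q != 0.
Proof. by move=> hg; apply: expf_neq0; apply: (unit0_neq0 hg). Qed.

Section FrobeniusStable.
Variable U : set (expo n).
Hypothesis UB : U `<=` cone a.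
Hypothesis UM : forall u w, cone a u -> U w -> U (eadd (emul q u) w).

(** The localization of the submodule of [F^e_* B] spanned by the exponents in
    [U]. *)
Definition loc_span : set F :=
  [set x | exists f g, [/\ monspan k U f, unit0 g & x = tof f / tof g ^+ q]].

Lemma span_frobM r f : B r -> monspan k U f -> monspan k U (r ^+ q * f).
Proof.
move=> hr hf; apply: (spanM (U := [set w | exists2 u, cone a u & w = emul q u])) hf.
  by move=> _ w [u cu ->]; apply: UM.
rewrite qE polyX_Frobenius // -qE big_seq; apply: big_ind => [||w].
- exact: span0.
- exact: spanD.
- by rewrite mem_esupp => /hr cw; apply: span_term; exists w.
Qed.

Lemma loc_span_submodule : frob_submodule L q loc_span.
Proof.
split.
- move=> x [f [g [hf hg ->]]]; rewrite -rmorphXn; apply/locP; exists f, (g ^+ q).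
  by split=> //; [apply: span_sub hf|apply: unit0X].
- exists 0, 1; split; [exact: span0|exact: unit01|].
  by rewrite rmorph0 mul0r.
- move=> _ _ [f [g [hf hg ->]]] [f' [g' [hf' hg' ->]]].
  exists (g' ^+ q * f + g ^+ q * f'), (g * g'); split.
  + by apply: spanD; apply: span_frobM => //; [case: hg'|case: hg].
  + exact: unit0M.
  + rewrite (addf_div _ _ (unit0_pow_neq0 hg) (unit0_pow_neq0 hg')).
    by rewrite tofracD !tofracM !tofracXn exprMn [tof f * _]mulrC [tof f' * _]mulrC.
- move=> _ _ /locP[r [h [hr hh ->]]] [f [g [hf hg ->]]].
  exists (r ^+ q * f), (h * g); split.
  + exact: span_frobM.
  + exact: unit0M.
  + by rewrite expr_div_n mulf_div !tofracM tofracXn exprMn.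
Qed.

End FrobeniusStable.

(** The exponents of the free summand and of its complement. *)
Definition free_exp : set (expo n) :=
  [set w | exists t v, cone a v /\ w = eadd (W t) (emul q v)].

Definition cofree_exp : set (expo n) := [set w | cone a w /\ ~ free_exp w].

Lemma W_cone t : cone a (W t).
Proof. by have [] : frob_box a q (W t) by apply/WP; exists t. Qed.

Lemma W_uniq t t' v v' :
  eadd (W t) (emul q v) = eadd (W t') (emul q v') -> t = t' /\ v = v'.
Proof.
move=> h; have bt s : frob_box a q (W s) by apply/WP; exists s.
have vv' : v = v'.
  apply: (@fle_anti _ a).
    exact: frob_box_cancel (W_cone t) (bt t') h.
  exact: frob_box_cancel (W_cone t') (bt t) (esym h).
split=> //; apply: W_inj; apply: (@eaddI _ (emul q v)).
by rewrite eaddC h vv' eaddC.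
Qed.

Lemma free_exp_cone : free_exp `<=` cone a.
Proof. by move=> _ [t [v [cv ->]]]; apply: coneD (W_cone t) (coneM _ cv). Qed.

Lemma emulD (u v : expo n) : emul q (eadd u v) = eadd (emul q u) (emul q v).
Proof. by apply: expoP => i; rewrite !mulmnE !mnmDE !mulmnE mulnDl. Qed.

Lemma free_expM u w : cone a u -> free_exp w -> free_exp (eadd (emul q u) w).
Proof.
move=> cu [t [v [cv ->]]]; exists t, (eadd u v); split; first exact: coneD.
by rewrite emulD !eaddA (eaddC _ (W t)).
Qed.

(** If [w + q u = s + q v] with [s] in the box then [v - u] lies in the cone, so
    [w] is congruent to [s] already inside the cone. *)
Lemma cofree_expM u w : cone a u -> cofree_exp w -> cofree_exp (eadd (emul q u) w).
Proof.
move=> cu [cw nw]; split; first exact: coneD (coneM _ cu) cw.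
move=> [t [v [cv h]]]; apply: nw.
have bt : frob_box a q (W t) by apply/WP; exists t.
have : fle a u v by apply: (frob_box_cancel cw bt); rewrite eaddC.
move=> /fleP[v' cv' vE]; exists t, v'; split=> //.
by apply: (@eaddI _ (emul q u)); rewrite h vE emulD !eaddA (eaddC _ (W t)).
Qed.

Lemma span_split (D : set (expo n)) f : B f -> exists f1 f2,
  [/\ monspan k [set w | cone a w /\ D w] f1,
      monspan k [set w | cone a w /\ ~ D w] f2 & f = f1 + f2].
Proof.
move: f; apply: span_ind.
- by exists 0, 0; rewrite addr0; split=> //; apply: span0.
- move=> _ _ [f1 [f2 [h1 h2 ->]]] [g1 [g2 [h1' h2' ->]]].
  by exists (f1 + g1), (f2 + g2); rewrite addrACA; split=> //; apply: spanD.
- move=> x w cw; have [Dw|nDw] := pselect (D w).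
    by exists (econst n x * mono k w), 0; rewrite addr0; split;
      [exact: span_term|exact: span0|].
  by exists 0, (econst n x * mono k w); rewrite add0r; split;
    [exact: span0|exact: span_term|].
Qed.

Let gen (i : T * Om) : P := econst n (om i.2) * mono k (W i.1).

(** By [W_uniq] the coefficient at [W t + q v] isolates a combination of the
    basis [om] with coefficients in [k^q]. *)
Lemma frob_combination_free (r : T * Om -> P) :
  \sum_i r i ^+ q * gen i = 0 -> forall i, r i = 0.
Proof.
move=> r0 [t0 b0]; apply: ecoef_inj => v; rewrite ecoef0.
have coefE i : ecoef (eadd (W t0) (emul q v)) (r i ^+ q * gen i) =
    (i.1 == t0)%:R * (ecoef v (r i) ^+ q * om i.2).
  rewrite /gen mulrCA ecoef_constM.
  transitivity (om i.2 * ((i.1 == t0)%:R * ecoef v (r i) ^+ q)); last by ring.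
  congr (_ * _).
  rewrite qE polyX_Frobenius // -qE mulr_suml ecoef_sum.
  have termE u : ecoef (eadd (W t0) (emul q v))
      (econst n (ecoef u (r i) ^+ q) * mono k (emul q u) * mono k (W i.1)) =
      ecoef u (r i) ^+ q * ((i.1 == t0) && (u == v))%:R.
    rewrite -mulrA -monoD ecoef_constM ecoef_mono eaddC; congr (_ * (nat_of_bool _)%:R).
    apply/eqP/andP => [/W_uniq[-> ->] //|[/eqP-> /eqP->]//].
  under eq_bigr => u _ do rewrite termE.
  have [_|] := eqVneq i.1 t0; last first.
    by rewrite mul0r => _; rewrite big1 // => u _; rewrite mulr0.
  rewrite mul1r /=; have [v0|vn] := boolP (v \in esupp (r i)).
    rewrite (bigD1_seq v) ?esupp_uniq //=.
    rewrite eqxx mulr1 big1 ?addr0 // => u /negbTE ->.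
    by rewrite mulr0.
  have -> : ecoef v (r i) = 0 by apply/eqP; rewrite -[_ == _]negbK -mem_esupp.
  rewrite expr0n eqn0Ngt q_gt0 big1_seq // => u /andP[_ us].
  have /negbTE -> : u != v by apply: contraNneq vn => <-.
  by rewrite mulr0.
move/(congr1 (ecoef (eadd (W t0) (emul q v)))): r0; rewrite ecoef0 ecoef_sum.
under eq_bigr => i _ do rewrite coefE.
have -> : \sum_(i : T * Om) (i.1 == t0)%:R * (ecoef v (r i) ^+ q * om i.2) =
    \sum_t \sum_b (t == t0)%:R * (ecoef v (r (t, b)) ^+ q * om b).
  by rewrite pair_bigA; apply: eq_bigr => -[].
rewrite (bigD1 t0) //= [X in _ + X]big1 ?addr0 => [|t /negbTE->]; last first.
  by rewrite big1 // => b _; rewrite mul0r.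
under eq_bigr => b _ do rewrite eqxx mul1r.
by move/om_basis.2.
Qed.

Lemma frob_combination_span f : monspan k free_exp f ->
  exists r : T * Om -> P, (forall i, B (r i)) /\ f = \sum_i r i ^+ q * gen i.
Proof.
move: f; apply: span_ind.
- exists (fun=> 0); split=> [i|]; first exact: span0.
  by rewrite big1 // => i _; rewrite expr0n eqn0Ngt q_gt0 mul0r.
- move=> _ _ [r [hr ->]] [r' [hr' ->]]; exists (fun i => r i + r' i); split.
    by move=> i; apply: spanD.
  by rewrite -big_split; apply: eq_bigr => i _; rewrite qE Frobenius_add // mulrDl.
- move=> x _ [t [v [cv ->]]]; have [c ->] := om_basis.1 x.
  exists (fun i => if i.1 == t then econst n (c i.2) * mono k v else 0); split.
    by move=> i; case: eqP => _; [apply: span_term|apply: span0].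
  transitivity (\sum_t' \sum_b (if t' == t then econst n (c b) * mono k v else 0) ^+ q *
     gen (t', b)); last by rewrite pair_bigA; apply: eq_bigr => -[].
  rewrite (bigD1 t) //= [X in _ + X]big1 ?addr0 => [|t' /negbTE->]; last first.
    by rewrite big1 // => b _; rewrite expr0n eqn0Ngt q_gt0 mul0r.
  have -> : econst n (\sum_i c i ^+ q * om i) = \sum_i econst n (c i ^+ q * om i) :> P.
    by rewrite /econst !rmorph_sum.
  rewrite mulr_suml; apply: eq_bigr => b _; rewrite eqxx econstM econstX monoD monoX.
  by rewrite [in RHS]exprMn /gen /=; ring.
Qed.

Lemma free_summand : frob_free_summand L q (#|T| * #|Om|).
Proof.
have sM := loc_span_submodule free_exp_cone free_expM.
have cofree_cone : cofree_exp `<=` cone a by move=> w [].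
have sN := loc_span_submodule cofree_cone cofree_expM.
exists (loc_span free_exp), (loc_span cofree_exp); split=> //.
- rewrite -card_prod; apply: (frob_free_fintype (w := fun i => tof (gen i))).
  + move=> i; exists (gen i), 1; split; [|exact: unit01|].
      apply: span_term; exists i.1, (ezero n); split; first exact: cone0.
      by apply: expoP => j; rewrite mnmDE mulmnE mnm0E addn0.
    by rewrite rmorph1 expr1n divr1.
  + move=> _ [f [g [/frob_combination_span[r [hr ->]] hg ->]]].
    exists (fun i => tof (r i) / tof g); split.
      by move=> i; apply/locP; exists (r i), g.
    rewrite rmorph_sum mulr_suml; apply: eq_bigr => i _.
    by rewrite rmorphM rmorphXn expr_div_n mulrAC.
  + move=> r r' hr hr' rr' i; apply/eqP; rewrite -subr_eq0; apply/eqP.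
    have Lr j : L (r j - r' j).
      apply: locD => //; rewrite -[- r' j]mulN1r; apply: locM => //.
      rewrite -(rmorph1 tof) -rmorphN; apply: loc_tof.
      by rewrite -(econst1 k n) -mpolyCN -mpolyCN; apply: econst_span; apply: cone0.
    have [g [f [hg hf]]] := loc_common_denom Lr.
    rewrite (hf i).2 (frob_combination_free (r := f)) ?rmorph0 ?mul0r //.
    apply/eqP; rewrite -tofrac_eq0 rmorph_sum /=.
    have -> : \sum_j tof (f j ^+ q * gen j) =
        tof g ^+ q * \sum_j (r j - r' j) ^+ q * tof (gen j).
      rewrite mulr_sumr; apply: eq_bigr => j _; rewrite (hf j).2 rmorphM rmorphXn.
      by rewrite mulrA -exprMn [tof g * _]mulrC divfK // (unit0_neq0 hg).
    rewrite (_ : \sum_j _ = 0) ?mulr0 //; apply/eqP.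
    move/eqP: rr'; rewrite -subr_eq0 -sumrB => /eqP rr'; rewrite -[X in _ == X]rr'.
    apply/eqP; apply: eq_bigr => j _.
    by rewrite qE Frobenius_add ?Frobenius_opp ?pchar_frac // mulrBl.
- apply/seteqP; split=> [x [[f [g [hf hg ->]]] [f' [g' [hf' hg' /eqP]]]]|x ->]; last first.
    by split; [case: sM|case: sN].
  rewrite (eqr_div _ _ (unit0_pow_neq0 hg) (unit0_pow_neq0 hg')).
  rewrite -!rmorphXn -!rmorphM tofrac_eq => /eqP ff'.
  suff fg0 : f * g' ^+ q = 0.
    move/eqP: fg0; rewrite mulf_eq0 expf_eq0 => /orP[/eqP->|/andP[_ /eqP g'0]].
      by rewrite rmorph0 mul0r.
    by have := unit0_neq0 hg'; rewrite g'0 rmorph0 eqxx.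
  apply: ecoef_inj => w; rewrite ecoef0; apply/eqP/negPn/negP => hw.
  have h1 : free_exp w.
    have /(_ w) h := span_frobM free_expM hg'.1 hf.
    by apply: h; rewrite [_ * f]mulrC.
  have [_ []//] : cofree_exp w.
  have /(_ w) h := span_frobM cofree_expM hg.1 hf'.
  by apply: h; rewrite [_ * f']mulrC -ff'.
- move=> x /loc_pow_denom[f [g [hf hg ->]]].
  have [f1 [f2 [h1 h2 ->]]] := span_split free_exp hf.
  exists (tof f1 / tof g ^+ q), (tof f2 / tof g ^+ q); split.
  + by exists f1, g; split=> //; apply: span_sub h1 => w [].
  + by exists f2, g.
  + by rewrite rmorphD mulrDl.
Qed.

End FreeSummand.

(** * The upper bound for the rank of a free summand *)

Section FrobeniusCoordinates.
Variables (A : comNzRingType) (p e : nat) (L M N : set A) (c : nat).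
Hypothesis hp : p \in [pchar A].
Variable q : nat.
Hypothesis qE : q = (p ^ e)%N.
Hypothesis L1 : L 1.
Hypothesis L0 : L 0.
Hypothesis LN1 : L (-1).
Hypothesis LD : forall x y, L x -> L y -> L (x + y).
Hypothesis LM : forall x y, L x -> L y -> L (x * y).
Hypothesis sM : frob_submodule L q M.
Hypothesis sN : frob_submodule L q N.
Hypothesis MN0 : M `&` N = [set 0].
Hypothesis MNL : forall x, L x -> exists y z, [/\ M y, N z & x = y + z].
Variable w : 'I_c -> A.
Hypothesis wM : forall i, M (w i).
Hypothesis wP : forall x, M x -> exists! r : {ffun 'I_c -> A},
  (forall i, L (r i)) /\ x = \sum_i r i ^+ q * w i.

Let is_coords (x : A) (r : {ffun 'I_c -> A}) : Prop :=
  (forall i, L (r i)) /\ exists2 z, N z & x = \sum_i r i ^+ q * w i + z.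

Let combM (r : {ffun 'I_c -> A}) : (forall i, L (r i)) -> M (\sum_i r i ^+ q * w i).
Proof.
move=> hr; have [_ M0 MD MZ] := sM.
by apply: big_ind => // i _; apply: MZ.
Qed.

Let is_coords_uniq x r r' : is_coords x r -> is_coords x r' -> r = r'.
Proof.
move=> [hr [z hz ->]] [hr' [z' hz' e']].
have [_ _ MD MZ] := sM; have [_ _ ND NZ] := sN.
have NN y : N y -> N (- y).
  by move=> hy; rewrite -mulN1r -(expr1n _ q) qE -Frobenius_opp // -qE; apply: NZ.
have MN y : M y -> M (- y).
  by move=> hy; rewrite -mulN1r -(expr1n _ q) qE -Frobenius_opp // -qE; apply: MZ.
pose s (t : {ffun 'I_c -> A}) := \sum_i t i ^+ q * w i.
have e0 : s r - s r' = 0.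
  have : (M `&` N) (s r - s r').
    split; first by apply: MD; [apply: combM|apply: MN; apply: combM].
    have -> : s r - s r' = z' - z.
      by apply/eqP; rewrite subr_eq addrAC eq_sym subr_eq addrC -e' addrC.
    by apply: ND => //; apply: NN.
  by rewrite MN0.
have [t [_ tu]] := wP (combM hr).
rewrite -(tu r) // -(tu r') //; split=> //.
by apply/eqP; rewrite -subr_eq0 -/(s r) e0.
Qed.

(** The projection onto a free summand, read in its basis, is a family of
    linear maps from [F^e_* L] to [L] dual to that basis. *)
Lemma frob_coordinates : exists phi : A -> 'I_c -> A,
  [/\ forall x i, L x -> L (phi x i),
      forall x y i, L x -> L y -> phi (x + y) i = phi x i + phi y i,
      forall r x i, L r -> L x -> phi (r ^+ q * x) i = r * phi x i &
      forall i j, phi (w j) i = (i == j)%:R].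
Proof.
have [ML M0 MD MZ] := sM; have [NL N0 ND NZ] := sN.
have ex x : exists r, L x -> is_coords x r.
  have [Lx|nLx] := pselect (L x); last by exists [ffun=> 0].
  have [y [z [hy hz ->]]] := MNL Lx; have [r [[hr yE] _]] := wP hy.
  by exists r => _; split=> //; exists z => //; rewrite yE.
have {ex}/choice[phi phiP] := ex.
have q0 : (0 < q)%N.
  by rewrite qE expn_gt0 prime_gt0 // (pcharf_prime hp).
exists (fun x i => phi x i); split.
- by move=> x i /phiP[h _]; apply: h.
- move=> x y i Lx Ly; have [hx [z hz xE]] := phiP x Lx; have [hy [z' hz' yE]] := phiP y Ly.
  suff -> : phi (x + y) = [ffun i => phi x i + phi y i] by rewrite ffunE.
  apply: is_coords_uniq (phiP _ (LD Lx Ly)) _; split.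
    by move=> j; rewrite ffunE; apply: LD.
  exists (z + z'); first exact: ND.
  rewrite [in LHS]xE [in LHS]yE addrACA; congr (_ + _).
  rewrite -big_split; apply: eq_bigr => j _.
  by rewrite ffunE qE Frobenius_add // mulrDl.
- move=> r x i Lr Lx; have [hx [z hz xE]] := phiP x Lx.
  have Lrx : L (r ^+ q * x).
    by apply: LM => //; elim: (q) => [|m IHm]; rewrite ?expr0 // exprS; apply: LM.
  suff -> : phi (r ^+ q * x) = [ffun i => r * phi x i] by rewrite ffunE.
  apply: is_coords_uniq (phiP _ Lrx) _; split.
    by move=> j; rewrite ffunE; apply: LM.
  exists (r ^+ q * z); first exact: NZ.
  rewrite [in LHS]xE mulrDr mulr_sumr; congr (_ + _).
  by apply: eq_bigr => j _; rewrite ffunE exprMn mulrA.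
- move=> i j; have Lw : L (w j) by apply: ML.
  suff -> : phi (w j) = [ffun i => (i == j)%:R] by rewrite ffunE.
  apply: is_coords_uniq (phiP _ Lw) _; split.
    by move=> l; rewrite ffunE; case: (l == j).
  exists 0 => //; rewrite addr0 (bigD1 j) //= ffunE eqxx expr1n mul1r big1 ?addr0 //.
  by move=> l /negbTE lj; rewrite ffunE lj expr0n eqn0Ngt q0 mul0r.
Qed.

End FrobeniusCoordinates.

Section UpperBound.
Variables (k : fieldType) (n : nat) (a : 'I_n -> nat) (p e : nat).
Hypothesis hp : p \in [pchar k].
Hypothesis a_gt0 : forall i, (0 < a i)%N.
Variable q : nat.
Hypothesis qE : q = (p ^ e)%N.
Variables (Om : finType) (om : Om -> k).
Hypothesis om_basis : frob_basis q om.
Variables (T : finType) (W : T -> expo n).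
Hypothesis WP : forall w, frob_box a q w <-> exists t, w = W t.
Local Notation P := (polyRuv k n).
Local Notation B := (monspan k (cone a)).
Local Notation F := {fraction P}.
Local Notation L := (localization B (monspan k (max_exp a))).
Local Notation tof := (@FracField.tofrac P).
Local Notation unit0 := (@unit0 k n a).

Lemma tof_powM (g f : P) : tof (g ^+ q * f) = tof g ^+ q * tof f.
Proof. by rewrite tofracM tofracXn. Qed.

Section Functional.
Variable phi : F -> F.
Hypothesis phiL : forall x, L x -> L (phi x).
Hypothesis phiD : forall x y, L x -> L y -> phi (x + y) = phi x + phi y.
Hypothesis phiZ : forall r x, L r -> L x -> phi (r ^+ q * x) = r * phi x.

Let Bterm x w : cone a w -> B (econst n x * mono k w).
Proof. exact: span_term. Qed.

Let Bmono w : cone a w -> B (mono k w).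
Proof. exact: span_mono. Qed.

(** Take [y] and [z] from [not_frob_box].  Then [w + q y = q z + w'] with [w'] in
    the cone, so linearity gives [x^y phi(x^w) = x^z phi(x^w')].  A unit
    [phi(x^w)] would make [x^y] a multiple of [x^z], although [y - z] is
    negative on a facet. *)
Lemma residue_not_frob_box x w : cone a w -> ~ frob_box a q w ->
  residue (phi (tof (econst n x * mono k w))) = 0.
Proof.
move=> cw nw; have [y [z [cy cz nzy /fleP[w' cw' wE]]]] := not_frob_box a_gt0 cw nw.
set f := econst n x * mono k w; set f' := econst n x * mono k w'.
have Lf : L (tof f) by apply: loc_tof; apply: Bterm.
have Lf' : L (tof f') by apply: loc_tof; apply: Bterm.
have key : tof (mono k y) * phi (tof f) = tof (mono k z) * phi (tof f').
  have Ly : L (tof (mono k y)) by apply: loc_tof; apply: Bmono.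
  have Lz : L (tof (mono k z)) by apply: loc_tof; apply: Bmono.
  rewrite -(phiZ Ly Lf) -(phiZ Lz Lf').
  have yzE : mono k y ^+ q * f = mono k z ^+ q * f'.
    rewrite -!monoX /f /f' !(mulrCA _ (econst n x)) -!monoD.
    by rewrite (eaddC _ w) wE.
  by rewrite -(tof_powM (mono k y) f) yzE (tof_powM (mono k z) f').
have /locP[g [h [Bg hh gh]]] := phiL Lf.
have /locP[g' [h' [Bg' hh' gh']]] := phiL Lf'.
rewrite gh (residueE _ hh.2).
move: key; rewrite gh gh' !mulrA => /eqP.
rewrite (eqr_div _ _ (unit0_neq0 hh) (unit0_neq0 hh')) -!tofracM tofrac_eq => /eqP key.
have : ecoef y (mono k z * g' * h) = 0.
  apply/eqP/negPn/negP; rewrite -mulrA => /ecoef_monoM_neq0[v yE hv].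
  apply: nzy; apply/fleP; exists v => //.
  by apply: (spanM (@coneD n a) Bg' hh.1).
rewrite -key -mulrA -{1}(eadd0 y) ecoef_monoM ecoef0M => /eqP.
by rewrite mulf_eq0 (negbTE hh'.2) orbF => /eqP ->; rewrite mul0r.
Qed.

End Functional.

(** Modulo the maximal ideal a linear functional only sees the exponents in the
    box, and is determined there by its values on a basis over [k^q]. *)
Lemma residue_comb f : B f -> exists mu : T * Om -> k, forall phi : F -> F,
  (forall x, L x -> L (phi x)) ->
  (forall x y, L x -> L y -> phi (x + y) = phi x + phi y) ->
  (forall r x, L r -> L x -> phi (r ^+ q * x) = r * phi x) ->
  residue (phi (tof f)) =
  \sum_i mu i * residue (phi (tof (econst n (om i.2) * mono k (W i.1)))).
Proof.
move=> hf; suff [] : B f /\ exists mu : T * Om -> k, forall phi : F -> F,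
  (forall x, L x -> L (phi x)) ->
  (forall x y, L x -> L y -> phi (x + y) = phi x + phi y) ->
  (forall r x, L r -> L x -> phi (r ^+ q * x) = r * phi x) ->
  residue (phi (tof f)) =
  \sum_i mu i * residue (phi (tof (econst n (om i.2) * mono k (W i.1)))) by [].
have phi0 (phi : F -> F) : (forall x y, L x -> L y -> phi (x + y) = phi x + phi y) ->
    phi 0 = 0.
  move=> phiD; have /eqP := phiD 0 0 (loc0 k a) (loc0 k a).
  by rewrite addr0 -subr_eq subrr eq_sym => /eqP.
move: f hf; apply: span_ind.
- split; first exact: span0.
  exists (fun=> 0) => phi phiL phiD phiZ.
  rewrite big1 ?rmorph0 ?phi0 // => [|i _]; last by rewrite mul0r.
  by rewrite -(rmorph0 tof) residue_tof ecoef0.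
- move=> f g [hf [mu hmu]] [hg [nu hnu]]; split; first exact: spanD.
  exists (fun i => mu i + nu i) => phi phiL phiD phiZ.
  have Lf : L (tof f) by apply: loc_tof.
  have Lg : L (tof g) by apply: loc_tof.
  rewrite rmorphD phiD // (residueD (phiL _ Lf) (phiL _ Lg)) hmu // hnu // -big_split.
  by apply: eq_bigr => i _; rewrite mulrDl.
- move=> x w cw; split; first exact: span_term.
  have [bw|nbw] := pselect (frob_box a q w); last first.
    exists (fun=> 0) => phi phiL phiD phiZ.
    rewrite (residue_not_frob_box phiL phiZ _ cw nbw) big1 // => i _.
    by rewrite mul0r.
  have /WP[t wE] := bw; have [c ->] := om_basis.1 x.
  exists (fun i => if i.1 == t then c i.2 else 0) => phi phiL phiD phiZ.
  have Bt b : B (econst n (om b) * mono k (W t)) by rewrite -wE; apply: span_term.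
  have Lt b : L (tof (econst n (om b) * mono k (W t))) by apply: loc_tof.
  have Lc b : L (tof (econst n (c b))).
    by apply: loc_tof; apply: econst_span; apply: cone0.
  transitivity (\sum_t' \sum_b (if t' == t then c b else 0) *
    residue (phi (tof (econst n (om b) * mono k (W t'))))); last first.
    by rewrite pair_bigA; apply: eq_bigr => -[].
  rewrite (bigD1 t) //= [X in _ + X]big1 ?addr0 => [|t' /negbTE->]; last first.
    by rewrite big1 // => b _; rewrite mul0r.
  have -> : econst n (\sum_i c i ^+ q * om i) = \sum_i econst n (c i ^+ q * om i) :> P.
    by rewrite /econst !rmorph_sum.
  rewrite mulr_suml rmorph_sum /=.
  have termE b : tof (econst n (c b ^+ q * om b) * mono k w) =
      tof (econst n (c b)) ^+ q * tof (econst n (om b) * mono k (W t)).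
    by rewrite -tofracXn -tofracM econstM econstX wE mulrA.
  have Lterm b : L (tof (econst n (c b ^+ q * om b) * mono k w)).
    by apply: loc_tof; apply: span_term.
  rewrite eqxx.
  suff : forall s : seq Om,
    L (\sum_(b <- s) tof (econst n (c b ^+ q * om b) * mono k w)) /\
    residue (phi (\sum_(b <- s) tof (econst n (c b ^+ q * om b) * mono k w))) =
    \sum_(b <- s) c b * residue (phi (tof (econst n (om b) * mono k (W t)))).
    by move=> h; apply: (h _).2.
  elim=> [|b s [Ls IHs]].
    rewrite !big_nil phi0 //; split; first exact: loc0.
    by rewrite -(rmorph0 tof) residue_tof ecoef0.
  rewrite !big_cons; split; first exact: locD.
  rewrite phiD // (residueD (phiL _ (Lterm b)) (phiL _ Ls)) IHs; congr (_ + _).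
  rewrite termE (phiZ _ _ (Lc b) (Lt b)) (residueM (Lc b) (phiL _ (Lt b))) residue_tof.
  by rewrite -[econst n (c b)]mulr1 ecoef_constM ecoef0_1 mulr1.
Qed.

(** After clearing denominators in the basis of the summand, the dual
    functionals give an invertible scalar matrix, which [residue_comb] factors
    through the span of the box. *)
Lemma free_summand_le c : frob_free_summand L q c -> (c <= #|T| * #|Om|)%N.
Proof.
move=> [M [N [sM sN [w wM wP] MN0 MNL]]].
have hF : p \in [pchar F] by apply: pchar_frac hp.
have L1 : L 1 by rewrite -(rmorph1 tof); apply: loc_tof; case: (unit01 k a).
have LN1 : L (-1).
  rewrite -(rmorph1 tof) -rmorphN; apply: loc_tof.
  by rewrite -(econst1 k n) -mpolyCN -mpolyCN; apply: econst_span; apply: cone0.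
have [phi [phiL phiD phiZ phiw]] := frob_coordinates hF qE L1 (loc0 k a) LN1
  (@locD k n a) (@locM k n a) sM sN MN0 MNL wM wP.
have Lw j : L (w j) by case: sM => ML _ _ _; apply: ML.
have [g [f [hg hf]]] := loc_common_denom Lw.
have q0 : (0 < q)%N by rewrite qE expn_gt0 prime_gt0 // (pcharf_prime hp).
pose h j := g ^+ q.-1 * f j.
have Bh j : B (h j).
  by apply: (spanM (@coneD n a)); [apply: spanX; case: hg|case: (hf j)].
have hE j : tof (h j) = tof g ^+ q * w j.
  rewrite (hf j).2 /h tofracM tofracXn -[in RHS](prednK q0) exprSr -mulrA.
  by congr (_ * _); rewrite mulrCA divff ?mulr1 // (unit0_neq0 hg).
have Lg : L (tof g) by apply: loc_tof; case: hg.
have phih i j : residue (phi (tof (h j)) i) = ecoef (ezero n) g * (i == j)%:R.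
  rewrite hE phiZ // phiw; case: (i == j).
    by rewrite !mulr1 residue_tof.
  by rewrite !mulr0 -(rmorph0 tof) residue_tof ecoef0.
have /choice[mu hmu] j := residue_comb (Bh j).
pose gen (i : T * Om) := tof (econst n (om i.2) * mono k (W i.1)).
pose M1 := \matrix_(j < c, i < #|{: T * Om}|) mu j (enum_val i).
pose M2 := \matrix_(i < #|{: T * Om}|, j < c) residue (phi (gen (enum_val i)) j).
have : M1 *m M2 = (ecoef (ezero n) g)%:M.
  apply/matrixP => j i; rewrite !mxE.
  transitivity (residue (phi (tof (h j)) i)); last first.
    by rewrite phih eq_sym mulr_natr.
  rewrite (hmu j (fun x => phi x i)); first last.
  - by move=> *; apply: phiZ.
  - by move=> *; apply: phiD.
  - by move=> *; apply: phiL.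
  rewrite [RHS](reindex_onto enum_val enum_rank) => [|x _]; last exact: enum_rankK.
  by apply: eq_big => x; rewrite ?enum_valK ?eqxx // !mxE.
move=> M12; have := mulmx_max_rank M1 M2.
by rewrite M12 -scalemx1 mxrank_scale_nz ?hg.2 // mxrank1 card_prod.
Qed.

End UpperBound.

Section FreeRank.
Variables (k : fieldType) (n : nat) (a : 'I_n -> nat).

Lemma box_exp_sub_inj q (A : pred (box n q)) : (forall x, A x -> box_ok x) ->
  injective (fun x : {x : box n q | A x} => box_exp a (val x)).
Proof.
by move=> Aok [x hx] [y hy] /= h; apply/val_inj/(@box_exp_inj _ a) => //=; apply: Aok.
Qed.

Lemma sig_box_ok q (x : box n q) : sig_box a x -> box_ok x.
Proof. by case: x => d [[b s] t] /andP[]. Qed.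

Lemma max_free_rankE (R : realType) p D e : p \in [pchar k] -> (forall i, (0 < a i)%N) ->
  frob_degree k p D ->
  max_free_rank R (localization (int_alg k a a) (int_alg_max k a a)) (p ^ e) =
  ((#|[pred x | sig_box a (q := p ^ e) x]| * D ^ e)%:R)%:E.
Proof.
move=> hp a_gt0 hD; rewrite int_algE int_alg_maxE.
have [Om [om [<- om_basis]]] := frob_basis_iter hp hD e.
rewrite -card_sig; pose T : finType := {x : box n (p ^ e) | sig_box a x}.
pose W (x : T) := box_exp a (val x).
have W_inj : injective W by apply: box_exp_sub_inj => x; apply: sig_box_ok.
have WP w : frob_box a (p ^ e) w <-> exists t, w = W t by apply: sig_boxP.
apply/eqP; rewrite eq_le; apply/andP; split.
  apply: ub_ereal_sup => _ [c hc <-]; rewrite lee_fin ler_nat.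
  exact: (free_summand_le hp a_gt0 (erefl _) om_basis WP hc).
apply: ereal_sup_ubound; exists (#|T| * #|Om|)%N => //.
exact: (free_summand hp (erefl _) om_basis W_inj WP).
Qed.

End FreeRank.

(** * Riemann sums *)

Section RiemannSums.
Variables (R : realType) (q : nat -> nat) (A : nat).
Hypothesis q_gt0 : forall e, (0 < q e)%N.
Hypothesis q_cvg : ((q e)%:R^-1 : R) @[e --> \oo] --> 0.
Hypothesis A_gt0 : (0 < A)%N.

Lemma exprS_diff_bounds j (x : R) : 0 <= x ->
  j.+1%:R * x ^+ j <= (x + 1) ^+ j.+1 - x ^+ j.+1 <= j.+1%:R * (x + 1) ^+ j.
Proof.
move=> x0; rewrite subrXX addrC addKr mul1r.
have lx : x <= x + 1 by rewrite lerDl.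
have x1 : 0 <= x + 1 by rewrite addr_ge0.
have cE (y : R) : j.+1%:R * y = \sum_(i < j.+1) y by rewrite sumr_const card_ord mulr_natl.
rewrite !cE; apply/andP; split; apply: ler_sum => i _.
  have -> : x ^+ j = x ^+ (j.+1.-1 - i) * x ^+ i.
    by rewrite -exprD subnK // -ltnS.
  by rewrite ler_wpM2r ?exprn_ge0 // lerXn2r ?nnegrE.
have -> : (x + 1) ^+ j = (x + 1) ^+ (j.+1.-1 - i) * (x + 1) ^+ i.
  by rewrite -exprD subnK // -ltnS.
by rewrite ler_wpM2l ?exprn_ge0 // lerXn2r ?nnegrE.
Qed.

(** Summing the bounds for the increments of [x^(j+1)]. *)
Lemma power_sum_bounds j m :
  m%:R ^+ j.+1 / j.+1%:R <= (\sum_(t < m.+1) t%:R ^+ j : R)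
    <= m.+1%:R ^+ j.+1 / j.+1%:R.
Proof.
have j0 : (0 : R) < j.+1%:R by rewrite ltr0n.
apply/andP; split.
  rewrite ler_pdivrMr //; elim: m => [|m IHm].
    by rewrite expr0n /= mulr_ge0 // sumr_ge0 // => i _; rewrite exprn_ge0.
  rewrite big_ord_recr /= mulrDl.
  have /andP[_] := exprS_diff_bounds j (ler0n R m).
  rewrite natr1 lerBlDr => /le_trans; apply.
  by rewrite addrC [_ * m.+1%:R ^+ j]mulrC lerD2r.
rewrite ler_pdivlMr //; elim: m => [|m IHm].
  have /andP[h _] := exprS_diff_bounds j (lexx (0 : R)).
  by rewrite big_ord1 mulrC; move: h; rewrite add0r (expr0n _ j.+1) subr0.
rewrite big_ord_recr /= mulrDl.
have /andP[h _] := exprS_diff_bounds j (ler0n R m.+1).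
move: h; rewrite lerBrDr natr1 => h; apply: le_trans h.
by rewrite addrC [_ * j.+1%:R]mulrC lerD2l.
Qed.

(** The integral of [f] over [[0, 1/A]] is [I], in the sense of the Riemann sums
    with step [1/q]. *)
Definition riemann_cvg (f : R -> R) (I : R) : Prop :=
  (q e)%:R^-1 * \sum_(t < (q e %/ A).+1) f (t%:R / (q e)%:R) @[e --> \oo] --> I.

Lemma riemann_cvg_ext f g I : f =1 g -> riemann_cvg f I -> riemann_cvg g I.
Proof.
by move=> fg; rewrite /riemann_cvg (_ : f = g) //; apply/funext.
Qed.

Lemma riemann_cvgD f g I J : riemann_cvg f I -> riemann_cvg g J ->
  riemann_cvg (fun y => f y + g y) (I + J).
Proof.
move=> hf hg; rewrite /riemann_cvg.
under eq_fun do rewrite big_split mulrDr.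
exact: cvgD.
Qed.

Lemma riemann_cvgZ c f I : riemann_cvg f I -> riemann_cvg (fun y => c * f y) (c * I).
Proof.
move=> hf; rewrite /riemann_cvg.
under eq_fun do rewrite -mulr_sumr mulrCA.
by apply: cvgM; [exact: cvg_cst|exact: hf].
Qed.

Lemma riemann_cvg0 : riemann_cvg (fun=> 0) 0.
Proof.
rewrite /riemann_cvg; under eq_fun do rewrite big1 // mulr0.
exact: cvg_cst.
Qed.

Lemma riemann_cvg_sum (J : finType) (f : J -> R -> R) (I : J -> R) :
  (forall j, riemann_cvg (f j) (I j)) ->
  riemann_cvg (fun y => \sum_j f j y) (\sum_j I j).
Proof.
move=> h; elim: (index_enum J) => [|j s IHs].
  rewrite big_nil; apply: riemann_cvg_ext riemann_cvg0 => y.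
  by rewrite big_nil.
rewrite big_cons; apply: riemann_cvg_ext (riemann_cvgD (h j) IHs) => y.
by rewrite big_cons.
Qed.

Lemma div_cvg : ((q e %/ A)%:R / (q e)%:R : R) @[e --> \oo] --> (A%:R^-1 : R).
Proof.
have A0 : (0 : R) < A%:R by rewrite ltr0n.
apply: (@squeeze_cvgr _ _ _ _ (fun e => A%:R^-1 - (q e)%:R^-1) (fun=> A%:R^-1)).
- near=> e; have q0 : (0 : R) < (q e)%:R by rewrite ltr0n.
  have h1 : ((q e %/ A)%:R * A%:R : R) <= (q e)%:R.
    by rewrite -natrM ler_nat leq_divM.
  have h2 : ((q e)%:R : R) <= ((q e %/ A)%:R + 1) * A%:R.
    by rewrite natr1 -natrM ler_nat ltnW // ltn_ceil.
  apply/andP; split; last by rewrite ler_pdivrMr // mulrC ler_pdivlMr.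
  rewrite lerBlDr -[X in _ <= _ + X]mul1r -mulrDl ler_pdivlMr // mulrC.
  by rewrite ler_pdivrMr.
- rewrite -[X in _ --> X]subr0; apply: cvgB => //; exact: cvg_cst.
- exact: cvg_cst.
Unshelve. all: by end_near. Qed.

Lemma riemann_cvg_exp j : riemann_cvg (fun y => y ^+ j) (A%:R^-1 ^+ j.+1 / j.+1%:R).
Proof.
have cX (u : nat -> R) (l : R) : u e @[e --> \oo] --> l ->
    (u e ^+ j.+1 / j.+1%:R) @[e --> \oo] --> l ^+ j.+1 / j.+1%:R.
  move=> ul; apply: cvgM; last exact: cvg_cst.
  exact: (cvg_comp _ _ ul (@exprn_continuous R j.+1 l)).
have j0 : (0 : R) < j.+1%:R by rewrite ltr0n.
apply: (@squeeze_cvgr _ _ _ _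
  (fun e => ((q e %/ A)%:R / (q e)%:R) ^+ j.+1 / j.+1%:R)
  (fun e => ((q e %/ A)%:R / (q e)%:R + (q e)%:R^-1) ^+ j.+1 / j.+1%:R)).
- near=> e; have q0 : (0 : R) < (q e)%:R by rewrite ltr0n.
  have -> : (q e)%:R^-1 * \sum_(t < (q e %/ A).+1) (t%:R / (q e)%:R) ^+ j =
      (\sum_(t < (q e %/ A).+1) t%:R ^+ j) / (q e)%:R ^+ j.+1 :> R.
    rewrite mulr_sumr mulr_suml; apply: eq_bigr => t _.
    by rewrite expr_div_n exprS invfM mulrCA.
  have /andP[h1 h2] := power_sum_bounds j (q e %/ A).
  rewrite -[X in _ + X]mul1r -mulrDl natr1 !expr_div_n.
  rewrite mulrAC [X in _ && (_ <= X)]mulrAC.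
  by rewrite !ler_pM2r ?invr_gt0 ?exprn_gt0 // h1 h2.
- by apply: cX; apply: div_cvg.
- apply: cX; rewrite -[X in _ --> X]addr0; apply: cvgD => //; exact: div_cvg.
Unshelve. all: by end_near. Qed.

(** Linearity reduces the claim to monomials, hence to [power_sum_bounds]. *)
Lemma riemann_cvg_poly (P : {poly R}) : exists I, riemann_cvg (horner P) I.
Proof.
exists (\sum_(i < size P) P`_i * (A%:R^-1 ^+ i.+1 / i.+1%:R)).
apply: (@riemann_cvg_ext (fun y => \sum_(i < size P) P`_i * y ^+ i)).
  by move=> y; rewrite horner_coef.
apply: (@riemann_cvg_sum 'I_(size P) (fun i y => P`_i * y ^+ i)) => i.
by apply: riemann_cvgZ; apply: riemann_cvg_exp.
Qed.

Variables (n : nat) (a : 'I_n -> nat).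
Hypothesis a_le : forall i, (a i <= A)%N.
Hypothesis a_max : exists i, a i = A.

(** The truncated factor [q - A t] vanishes as soon as [t >= q / A], so only the
    range in which all factors are genuine differences contributes. *)
Lemma sum_cornerE e :
  (\sum_(t < q e) (q e - t) * corner a (q e) t)%:R =
  (q e)%:R ^+ n.+1 * \sum_(t < (q e %/ A).+1)
    ((1 - t%:R / (q e)%:R) * \prod_i (1 - (a i)%:R * (t%:R / (q e)%:R))) :> R.
Proof.
have q0 : ((q e)%:R : R) != 0 by rewrite pnatr_eq0 -lt0n.
transitivity ((\sum_(t < (q e).+1) (q e - t) * corner a (q e) t)%:R : R).
  by rewrite big_ord_recr /= subnn mul0n addn0.
have hw : ((q e %/ A).+1 <= (q e).+1)%N by rewrite ltnS leq_div.
rewrite (big_ord_widen _ (fun t => (1 - t%:R / (q e)%:R) *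
  \prod_i (1 - (a i)%:R * (t%:R / (q e)%:R))) hw).
rewrite [in RHS]big_mkcond mulr_sumr natr_sum; apply: eq_bigr => t _.
rewrite ltnS leq_divRL //; have [le|lt] := leqP (t * A) (q e); last first.
  rewrite mulr0; have [i ai] := a_max.
  have -> : corner a (q e) t = 0%N.
    by rewrite /corner (bigD1 i) //= ai [(A * t)%N]mulnC (eqP (ltnW lt)) mul0n.
  by rewrite muln0.
rewrite natrM natrB ?exprS; last by rewrite -ltnS.
have -> : (q e)%:R ^+ n = \prod_(i < n) (q e)%:R :> R by rewrite prodr_const card_ord.
rewrite mulrACA; congr (_ * _); first by field.
rewrite -big_split natr_prod; apply: eq_bigr => i _ /=.
rewrite natrB; last by rewrite (leq_trans _ le) // mulnC leq_mul.
by rewrite natrM; field.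
Qed.

Lemma sig_box_cvg I :
  riemann_cvg (fun y => (1 - y) * \prod_i (1 - (a i)%:R * y)) I ->
  ((#|[pred x | sig_box a (q := q e) x]|)%:R / (q e)%:R ^+ n.+2 : R) @[e --> \oo]
    --> 2 * I.
Proof.
move=> hI.
have E e : (#|[pred x | sig_box a (q := q e) x]|)%:R / (q e)%:R ^+ n.+2 =
    2 * ((q e)%:R^-1 * \sum_(t < (q e %/ A).+1)
    ((1 - t%:R / (q e)%:R) * \prod_i (1 - (a i)%:R * (t%:R / (q e)%:R)))) - (q e)%:R^-1 :> R.
  have q0 : ((q e)%:R : R) != 0 by rewrite pnatr_eq0 -lt0n.
  have := congr1 (fun m => m%:R : R) (card_sig_box a (q e)).
  rewrite natrD natrM sum_cornerE natrX => /eqP; rewrite eq_sym -subr_eq => /eqP <-.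
    rewrite (exprS _ n.+1); have := expf_neq0 n.+1 q0.
  move: (_ ^+ n.+1) (\sum_(t < _) _) => Q S Q0.
  by field; rewrite q0.
under eq_fun do rewrite E.
rewrite -(subr0 (2 * I)); apply: cvgB => //.
by apply: cvgM; [exact: cvg_cst|exact: hI].
Qed.

End RiemannSums.

(** * The two invariants as limits *)

Section Invariants.
Variables (R : realType) (k : fieldType) (p n : nat) (a : 'I_n -> nat).
Hypothesis hp : p \in [pchar k].
Hypothesis a_gt0 : forall i, (0 < a i)%N.

Lemma pchar_gt1 : (1 < p)%N.
Proof. exact: prime_gt1 (pcharf_prime hp). Qed.

Lemma pow_pchar_gt0 e : (0 < p ^ e)%N.
Proof. by rewrite expn_gt0 (ltnW pchar_gt1). Qed.

Lemma pow_pchar_cvg : ((p ^ e)%:R^-1 : R) @[e --> \oo] --> 0.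
Proof.
under eq_fun do rewrite natrX -exprVn.
apply: cvg_expr; rewrite normfV normr_nat invf_lt1 ?ltr1n ?pchar_gt1 //.
by rewrite ltr0n (ltnW pchar_gt1).
Qed.

(** The proportion of the box in [q^(n+2)], whose limit is the F-signature. *)
Definition sig_box_density (s : R) : Prop :=
  ((#|[pred x | sig_box a (q := p ^ e) x]|)%:R / (p ^ e)%:R ^+ n.+2 : R) @[e --> \oo]
    --> s.

Lemma eHK_of_density s : sig_box_density s -> int_alg_eHK k p a a (2 - s).
Proof.
move=> hs; rewrite /int_alg_eHK /is_HilbertKunz.
have E e : (quotient_length R (int_alg k a a)
    (bracket_pow (int_alg k a a) (int_alg_max k a a) (p ^ e)) *
    ((p%:R ^+ (e * n.+2))^-1)%:E)%E =
    (2 - #|[pred x | sig_box a (q := p ^ e) x]|%:R / (p ^ e)%:R ^+ n.+2)%:E :> \bar R.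
  rewrite HK_length // -EFinM; congr (_%:E).
  have q0 : ((p ^ e)%:R : R) ^+ n.+2 != 0.
    by rewrite expf_neq0 // pnatr_eq0 -lt0n pow_pchar_gt0.
  have := congr1 (fun m => m%:R : R) (card_hk_box a (p ^ e)).
  rewrite natrD natrM !natrX => /eqP; rewrite eq_sym -subr_eq => /eqP <-.
  by rewrite exprM -natrX mulrBl -mulrA divff // mulr1.
under eq_fun do rewrite E.
apply: cvg_EFin; first by near=> e.
by apply: cvgB; [exact: cvg_cst|exact: hs].
Unshelve. all: by end_near. Qed.

Lemma Fsig_of_density s : F_finite k p -> sig_box_density s -> int_alg_Fsig k p a a s.
Proof.
move=> [D hD] hs.
have p1 : (1 : R) < p%:R by rewrite ltr1n pchar_gt1.
have p0 : (0 : R) < p%:R by apply: lt_trans p1.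
have D0 : (0 < D)%N.
  rewrite lt0n; apply/eqP => D0; have [w hw] := hD; have [r [[_ h] _]] := hw 1.
  have : (1 : k) = 0.
    by rewrite h big1 // => i _; have := ltn_ord i; rewrite {2}D0.
  by move/eqP; rewrite oner_eq0.
have DR : (0 : R) < D%:R by rewrite ltr0n.
pose alpha : R := ln D%:R / ln p%:R.
have lnp : ln (p%:R : R) != 0 by rewrite gt_eqF // ln_gt0.
have hD' : p%:R `^ alpha = D%:R :> R.
  by rewrite /powR gt_eqF // /alpha divfK // lnK.
have pD : p%:R `^ (n.+2%:R + alpha) = p%:R ^+ n.+2 * D%:R :> R.
  rewrite powRD; first by rewrite hD' powR_mulrn // ltW.
  by apply/implyP => _; rewrite gt_eqF.
exists D, alpha; split=> //.
have E e : (max_free_rank R (localization (int_alg k a a) (int_alg_max k a a)) (p ^ e) *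
    ((p%:R `^ (e%:R * (n.+2%:R + alpha)))^-1)%:E)%E =
    (#|[pred x | sig_box a (q := p ^ e) x]|%:R / (p ^ e)%:R ^+ n.+2)%:E :> \bar R.
  rewrite (max_free_rankE R e hp a_gt0 hD) -EFinM; congr (_%:E).
  rewrite [e%:R * _]mulrC powRrM pD powR_mulrn; last first.
    by rewrite mulr_ge0 // exprn_ge0 // ltW.
  rewrite exprMn.
  rewrite natrM natrX invfM mulrACA divff ?mulr1 ?expf_neq0 ?gt_eqF //.
  by rewrite natrX -!exprM mulnC.
under eq_fun do rewrite E.
apply: cvg_EFin; first by near=> e.
exact: hs.
Unshelve. all: by end_near. Qed.

Lemma density_of_riemann (A : nat) I : (forall i, (a i <= A)%N) -> (exists i, a i = A) ->
  riemann_cvg (R := R) (fun e => p ^ e)%N A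
    (fun y => (1 - y) * \prod_i (1 - (a i)%:R * y)) I ->
  sig_box_density (2 * I).
Proof.
move=> a_le a_max hI.
have A_gt0 : (0 < A)%N by have [i <-] := a_max.
exact: (sig_box_cvg pow_pchar_gt0 pow_pchar_cvg A_gt0 a_le a_max hI).
Qed.

Lemma density_exists : (0 < n)%N -> exists s, sig_box_density s.
Proof.
move=> n_gt0; have [i0 _ a_le] := @arg_maxnP _ (Ordinal n_gt0) xpredT a isT.
have [I hI] := @riemann_cvg_poly R _ _ pow_pchar_gt0 pow_pchar_cvg (a_gt0 i0)
  ((1 - 'X) * \prod_i (1 - (a i)%:R *: 'X)).
exists (2 * I); apply: (density_of_riemann (A := a i0)) => [i||].
- exact: a_le.
- by exists i0.
- apply: riemann_cvg_ext hI => y; rewrite hornerM horner_prod !hornerE; congr (_ * _).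
  by apply: eq_bigr => i _; rewrite !hornerE.
Qed.

End Invariants.

(** * The closed formula *)

Section ClosedFormula.
Variable R : realType.

Lemma prod_1sub_elem_sym m (c : 'I_m -> nat) (y : R) :
  \prod_i (1 - (c i)%:R * y) = \sum_(j < m.+1) (-1) ^+ j * elem_sym R j c * y ^+ j.
Proof.
under eq_bigr => i _ do rewrite addrC.
rewrite bigA_distr (partition_big (fun J : {set 'I_m} => inord #|J| : 'I_m.+1) xpredT) //.
apply: eq_bigr => j _; rewrite /elem_sym /mesym rmorph_sum /= mulr_sumr mulr_suml.
apply: eq_big => [J|J /eqP Jj].
  rewrite -val_eqE /= inordK // ltnS.
  by rewrite -[leqRHS]card_ord max_card.
have {Jj} cJ : #|J| = j.
  by rewrite -Jj inordK // ltnS -[leqRHS]card_ord max_card.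
rewrite rmorph_prod /= -big_mkcond /=.
under [X in _ * X * _]eq_bigr => i _ do rewrite mevalXU.
under eq_bigr => i _ do rewrite -mulN1r mulrA.
by rewrite !big_split !prodr_const cJ.
Qed.

Lemma riemann_cvg_formula (q : nat -> nat) (m : nat) (a1 : nat) (c : 'I_m -> nat) :
  (forall e, 0 < q e)%N -> ((q e)%:R^-1 : R) @[e --> \oo] --> 0 -> (0 < a1)%N ->
  riemann_cvg (R := R) q a1 (fun y => (1 - y) * ((1 - a1%:R * y) * \prod_i (1 - (c i)%:R * y)))
   (\sum_(j < m.+1) ((-1) ^+ j * elem_sym R j c) *
      (a1%:R^-1 ^+ j.+1 / j.+1%:R + - (1 + a1%:R) * (a1%:R^-1 ^+ j.+2 / j.+2%:R)
       + a1%:R * (a1%:R^-1 ^+ j.+3 / j.+3%:R))).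
Proof.
move=> q0 qc a0.
pose t (j : 'I_m.+1) (y : R) := ((-1) ^+ j * elem_sym R j c) *
  (y ^+ j + - (1 + a1%:R) * y ^+ j.+1 + a1%:R * y ^+ j.+2).
apply: (@riemann_cvg_ext _ _ _ (fun y => \sum_j t j y)).
  move=> y; rewrite prod_1sub_elem_sym !mulr_sumr; apply: eq_bigr => j _.
  by rewrite /t !exprS; ring.
apply: riemann_cvg_sum => j; apply: riemann_cvgZ.
apply: riemann_cvgD; first apply: riemann_cvgD.
- exact: riemann_cvg_exp.
- by apply: riemann_cvgZ; apply: riemann_cvg_exp.
- by apply: riemann_cvgZ; apply: riemann_cvg_exp.
Qed.

(** Both sides agree term by term, since
    [1/(k(k+1)) - 1/(x(k+1)(k+2)) = (1-1/x)/(k(k+1)) + 2/(x k(k+1)(k+2))]. *)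
Lemma formula_sum (m : nat) (S : nat -> R) (x : R) : x != 0 ->
  2 * (\sum_(j < m.+1) ((-1) ^+ j * S j) *
      (x^-1 ^+ j.+1 / j.+1%:R + - (1 + x) * (x^-1 ^+ j.+2 / j.+2%:R)
       + x * (x^-1 ^+ j.+3 / j.+3%:R))) =
  2 * (1 - x^-1) * (\sum_(1 <= j < m.+2)
     (-1) ^+ j.+1 * S j.-1 / (j%:R * j.+1%:R * x ^+ j))
  + 4 * (\sum_(1 <= j < m.+2)
     (-1) ^+ j.+1 * S j.-1 / (j%:R * j.+1%:R * j.+2%:R * x ^+ j.+1)).
Proof.
move=> x0; rewrite !big_add1 /= !big_mkord !mulr_sumr -big_split /=.
apply: eq_bigr => j _.
have n1 : (j.+1%:R : R) != 0 by rewrite pnatr_eq0.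
have n2 : (j.+1%:R + 1 : R) != 0 by rewrite natr1 pnatr_eq0.
have n3 : (j.+1%:R + 1 + 1 : R) != 0 by rewrite !natr1 pnatr_eq0.
rewrite !exprVn !exprS -(natr1 j.+2) -(natr1 j.+1).
have := expf_neq0 j x0; move: n1 n2 n3.
move: (j.+1%:R : R) (x ^+ j) ((-1) ^+ j : R) (S j) => N X s Sj n1 n2 n3 X0.
by field; rewrite x0 X0 n1 n2 n3.
Qed.

End ClosedFormula.

Theorem corollary4p4 (R : realType) (k : fieldType) (p n : nat)
    (hp : p \in [pchar k]) (hn : (0 < n)%N) (a b : 'I_n -> nat)
    (ha : forall i, (0 < a i)%N) (hb : forall i, (0 < b i)%N)
    (hab : forall i, a i = b i) :
  let i1 : 'I_n := Ordinal hn in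
  let a1 : R := (a i1)%:R in
  let Sk (j : nat) : R := elem_sym R j (fun i : 'I_n.-1 => a (lift i1 i)) in
  [/\ F_finite k p ->
        exists s : R, int_alg_Fsig k p a b s /\ int_alg_eHK k p a b (2 - s),
      n = 1%N ->
        int_alg_eHK k p a b (2 - (3 * a1 - 1) / (3 * a1 ^+ 2)) /\
        2 - (3 * a1 - 1) / (3 * a1 ^+ 2) =
          (1 - 3 * a1 + 6 * a1 ^+ 2) / (3 * a1 ^+ 2)
    & (forall i j : 'I_n, (i <= j)%N -> (a j <= a i)%N) ->
        int_alg_eHK k p a b
          (2 - 2 * (1 - a1^-1) *
                 (\sum_(1 <= j < n.+1)
                    (-1) ^+ j.+1 * Sk j.-1 / (j%:R * j.+1%:R * a1 ^+ j))
             - 4 * (\sum_(1 <= j < n.+1)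
                    (-1) ^+ j.+1 * Sk j.-1 /
                    (j%:R * j.+1%:R * j.+2%:R * a1 ^+ j.+1)))].
Proof.
have ab : a = b by apply/funext.
subst b; clear hb hab.
move=> i1 a1 Sk.
have a10 : a1 != 0 by rewrite pnatr_eq0 -lt0n.
have sorted_case : (forall i j : 'I_n, (i <= j)%N -> (a j <= a i)%N) ->
  int_alg_eHK k p a a
    (2 - 2 * (1 - a1^-1) *
           (\sum_(1 <= j < n.+1)
              (-1) ^+ j.+1 * Sk j.-1 / (j%:R * j.+1%:R * a1 ^+ j))
       - 4 * (\sum_(1 <= j < n.+1)
              (-1) ^+ j.+1 * Sk j.-1 /
              (j%:R * j.+1%:R * j.+2%:R * a1 ^+ j.+1))).
  case: n hn a ha @i1 @a1 @Sk a10 => // m hn' a' ha' i1 a1 Sk a10 dec.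
  rewrite -addrA -opprD -formula_sum //; apply: eHK_of_density => //.
  apply: (density_of_riemann hp ha' (A := a' i1)) => [i||]; first exact: dec.
    by exists i1.
  have h := @riemann_cvg_formula R _ m (a' i1) (fun i : 'I_m => a' (lift i1 i))
    (pow_pchar_gt0 hp) (pow_pchar_cvg hp) (ha' i1).
  apply: riemann_cvg_ext h => y; congr (_ * _).
  rewrite [RHS]big_ord_recl; have -> : ord0 = i1 by apply/val_inj.
  by [].
split=> //.
- move=> Ffin; have [s hs] := density_exists R hp ha hn.
  by exists s; split; [exact: Fsig_of_density|exact: eHK_of_density].
- move=> n1; split; last by field.
  have : forall i j : 'I_n, (i <= j)%N -> (a j <= a i)%N.
    by rewrite n1 in a {ha sorted_case i1 a1 Sk a10} * => i j _; rewrite !ord1.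
  move/sorted_case; congr (int_alg_eHK k p a a _).
  rewrite n1 !big_nat1 /= {1 2}/Sk /elem_sym mesym0E rmorph1.
  by field.
Qed.
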